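(* Let $G,H$ be two countable abelian groups endowed with proper left-invariant metrics. The following conditions are equivalent: \begin{enumerate} \item the metric spaces $G,H$ are coarsely equivalent; \item $\mathrm{asdim}(G)=\mathrm{asdim}(H)$ and the spaces $G,H$ are either both large scale connected or both not large scale connected; \item $r_0(G)=r_0(H)$ and the groups $G,H$ are either both finitely generated or both infinitely generated (i.e. not finitely generated). \end{enumerate}
   Context: A metric is proper if all its closed balls are compact. A map $f:X\to Y$ between metric spaces is bornologous if for every $\delta<\infty$ the number $\sup\{\mathrm{diam}(f(A)):A\subset X,\ \mathrm{diam}(A)\le\delta\}$ is finite. Metric spaces $X,Y$ are coarsely equivalent if there are bornologous maps $f:X\to Y$, $g:Y\to X$ and a real constant $K$ with $\mathrm{dist}(g\circ f(x),x)\le K$ and $\mathrm{dist}(f\circ g(y),y)\le K$ for all $x\in X$, $y\in Y$. For a metric space $X$, $\mathrm{asdim}(X)\le n$ means that for every $D\in[0,\infty)$ there is a cover $\mathcal U$ of $X$ with $\sup_{U\in\mathcal U}\mathrm{diam}(U)<\infty$ that can be written as $\mathcal U=\mathcal U_0\cup\dots\cup\mathcal U_n$, where each $\mathcal U_i$ is $D$-discrete, i.e. $\inf\{\mathrm{dist}(u,v):u\in U,v\in V\}\ge D$ for any distinct $U,V\in\mathcal U_i$. The asymptotic dimension $\mathrm{asdim}(X)$ is the smallest integer $n\ge 0$ with $\mathrm{asdim}(X)\le n$, and $\mathrm{asdim}(X)=\infty$ if there is no such $n$. A metric space $X$ is large scale connected if for some $\varepsilon\in[0,\infty)$ any two points $x,y\in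 X$ can be linked by an $\varepsilon$-chain, i.e. a finite sequence $x=x_0,x_1,\dots,x_n=y$ with consecutive distances at most $\varepsilon$. The torsion-free rank of an abelian group $G$ is $r_0(G)=\sup\{n\in\{0,1,2,\dots\}:\mathbb Z^n\text{ is isomorphic to a subgroup of }G\}\in\{0,1,2,\dots\}\cup\{\infty\}$. *)

(* Defs.v *)
From HB Require Import structures.
From mathcomp Require Import all_boot all_order all_algebra.
From mathcomp Require Import all_classical all_reals all_analysis.

Set Implicit Arguments.
Unset Strict Implicit.
Unset Printing Implicit Defensive.

Import Order.TTheory GRing.Theory Num.Theory.

Local Open Scope classical_set_scope.
Local Open Scope ring_scope.

Record metric (R : numFieldType) (T : Type) := Metric {
  dist :> T -> T -> R ;
  distxx : forall x, dist x x = 0 ;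
  dist_positivity : forall x y, dist x y = 0 -> x = y ;
  dist_sym : forall x y, dist x y = dist y x ;
  dist_triangle : forall y x z, dist x z <= dist x y + dist y z
}.

(* [T] seen as a metric space: an alias is needed because [T] may carry several
   metrics, and because the library has no join of [metricType] and [zmodType]
   without a norm. *)
Definition metrized (R : numFieldType) (T : choiceType) (d : metric R T) : Type :=
  T.

HB.instance Definition _ (R : numFieldType) (T : choiceType) (d : metric R T) :=
  Choice.on (metrized d).

HB.instance Definition _ (R : numFieldType) (T : choiceType) (d : metric R T) :=
  @isMetric.Build R (metrized d) d
    (distxx d) (@dist_positivity _ _ d) (dist_sym d) (dist_triangle d).

Section MetricSpaces.
Variable R : realType.

(* The library's [closed_ball] is the closure of an open ball, which can be
   strictly smaller than the set below. *)
Definition proper_metric (X : metricType R) : Prop :=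
  forall (x : X) (r : R), compact [set y | mdist x y <= r].

(* [ereal_sup set0 = -oo], hence the maximum with 0. *)
Definition diam (X : metricType R) (A : set X) : \bar R :=
  maxe 0%E (ereal_sup [set (mdist p.1 p.2)%:E | p in A `*` A]).

Definition bornologous (X Y : metricType R) (f : X -> Y) : Prop :=
  forall delta : R,
    (ereal_sup [set diam (f @` A) | A in [set A | diam A <= delta%:E]]
       < +oo)%E.

Definition coarsely_equivalent (X Y : metricType R) : Prop :=
  exists (f : X -> Y) (g : Y -> X) (K : R),
    [/\ bornologous f, bornologous g,
        forall x, mdist (g (f x)) x <= K
      & forall y, mdist (f (g y)) y <= K].

Definition discrete_family (X : metricType R) (D : R) (F : set (set X)) : Prop :=
  forall U V, F U -> F V -> U <> V ->
    (D%:E <= ereal_inf [set (mdist p.1 p.2)%:E | p in U `*` V])%E.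

Definition asdim_le (X : metricType R) (n : nat) : Prop :=
  forall D : R, 0 <= D ->
    exists F : set (set X),
      [/\ cover F id = [set: X],
          (ereal_sup [set diam U | U in F] < +oo)%E
        & exists Fi : 'I_n.+1 -> set (set X),
            F = \bigcup_i Fi i /\ forall i, discrete_family D (Fi i)].

Definition asdim (X : metricType R) : \bar R :=
  if pselect (exists n, `[< asdim_le X n >]) is left ex_n
  then ((ex_minn ex_n)%:R)%:E else +oo%E.

Definition large_scale_connected (X : metricType R) : Prop :=
  exists2 eps : R, 0 <= eps &
    forall x y : X, exists s : seq X,
      path (fun u v => mdist u v <= eps) x s /\ last x s = y.

End MetricSpaces.

Section AbelianGroups.

Definition is_subgroup (G : zmodType) (A : set G) : Prop := zmod_closed [in A].

Definition finitely_generated (G : zmodType) : Prop :=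
  exists2 A : set G, finite_set A & smallest (@is_subgroup G) A = [set: G].

Definition embeds_Zn (G : zmodType) (n : nat) : Prop :=
  exists (A : set G) (f : {additive 'rV[int]_n -> G}),
    is_subgroup A /\ set_bij [set: 'rV[int]_n] A f.

Definition torsion_free_rank (R : realType) (G : zmodType) : \bar R :=
  ereal_sup [set (n%:R)%:E | n in [set n | embeds_Zn G n]].

Definition left_invariant (R : realType) (G : zmodType) (d : metric R G) : Prop :=
  forall g x y : G, d (g + x) (g + y) = d x y.

End AbelianGroups.

(* Main.v *)
(* Let g_0, g_1, ... generate G, let G_k be generated by g_0, ..., g_(k-1), and
   let m_k be the order of g_k modulo G_k (0 if infinite). Every element of G
   is uniquely a finite sum of w_k g_k with w_k reduced modulo m_k, and up to
   coarse equivalence the metric only sees the digits w_k: two elements are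
   close when their digits agree beyond some rank and are close below it. So G
   is coarsely a restricted product of copies of Z (where m_k = 0) and of
   finite sets. If there are infinitely many copies of Z, they absorb the finite
   factors. If there are n of them, G is coarsely Z^n when G is finitely
   generated, and otherwise Z^n times the set of natural numbers in a mixed
   radix system. All mixed radix systems are coarsely equivalent: choosing place
   values alternately from two of them, sparsely enough, one finds a single tree
   whose even levels form the first one and whose odd levels form the second.

   The asymptotic dimension is at most the rank n by an explicit colouring of
   Z^n with n + 1 colours. It is at least n by a discrete Poincare-Miranda
   theorem, proved by integrating over a torus, modulo 2, a product of n closed
   1-cochains. Large scale connectedness amounts to finite generation because
   balls are finite, by a Baire category argument. *)

Require Import Defs.
From HB Require Import structures.
From mathcomp Require Import all_boot all_order all_algebra.
From mathcomp Require Import all_classical all_reals all_analysis.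
From mathcomp Require Import zify ring lra.

Set Implicit Arguments.
Unset Strict Implicit.
Unset Printing Implicit Defensive.

Import Order.TTheory GRing.Theory Num.Theory.

(** * Mixed radix systems *)

Section Blocks.
Implicit Types U V : nat -> nat.

(** In a common tree for two radix systems the numbers of children cannot be taken constant: the
    ratios of place values need not divide one another. They are therefore allowed to vary between
    bounds a_i <= b_i, and only the number of grandchildren is exactly M_i everywhere. Splitting M_i
    evenly among c children keeps all blocks near M_i / c, so bounds at level i + 1 pass to level i.
    But each level is then determined by the one above it, and there is no top level to start from.
    Truncated towers are compared instead: the constants are chosen so that the first block of each
    level does not depend on the truncation, and agreement spreads from there. In the lower bound
    for the asymptotic dimension, coefficients modulo 2 remove orientations from the cochain
    calculus, and colours serve as indices of coordinates: with at most n colours, the coordinate of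
    Z^n indexed by a colour can be perturbed by a bounded amount so as to be constant near each
    class of that colour. *)

Definition strictly_increasing U := forall b, (U b < U b.+1)%N.

Lemma strictly_increasing_lt U x y :
  strictly_increasing U -> (x < y)%N -> (U x < U y)%N.
Proof.
move=> incU; elim: y => // y IHy; rewrite ltnS leq_eqVlt => /predU1P[->//|xy].
exact: ltn_trans (IHy xy) (incU y).
Qed.

Lemma strictly_increasing_le U x y :
  strictly_increasing U -> (x <= y)%N -> (U x <= U y)%N.
Proof.
move=> incU; rewrite leq_eqVlt => /predU1P[->//|xy].
exact/ltnW/strictly_increasing_lt.
Qed.

Lemma strictly_increasing_ge_id U x : strictly_increasing U -> (x <= U x)%N.
Proof. by move=> incU; elim: x => // x IHx; have := incU x; lia. Qed.

Fixpoint block U y :=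
  if y is y'.+1 then
    if (U (block U y').+1 <= y)%N then (block U y').+1 else block U y'
  else 0%N.

Lemma blockP U y : strictly_increasing U -> U 0 = 0 ->
  (U (block U y) <= y < U (block U y).+1)%N.
Proof.
move=> incU U0; elim: y => [|y IHy] /=; first by have := incU 0; rewrite U0; lia.
case: ifP => h; last by rewrite ltnNge h andbT; lia.
rewrite h /=; have := incU (block U y).+1; lia.
Qed.

Lemma block_unique U x y : strictly_increasing U -> U 0 = 0 ->
  (U x <= y < U x.+1)%N -> block U y = x.
Proof.
move=> incU U0 xy; have := blockP y incU U0; move: (block U y) => z zy.
case: (ltngtP z x) => // h.
  have := strictly_increasing_le incU h; lia.
have := strictly_increasing_le incU h; lia.
Qed.

(** The blocks of U whose indices lie in the b-th block of V fill the interval [M b, M (b + 1)).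
    Thus unequal blocks, grouped twice, compute an exact quotient. *)
Lemma block_comp U V M y : strictly_increasing U -> U 0 = 0 ->
    strictly_increasing V -> V 0 = 0 -> (0 < M)%N ->
    (forall b, U (V b) = (M * b)%N) ->
  block V (block U y) = (y %/ M)%N.
Proof.
move=> incU U0 incV V0 M0 UV.
have /andP[a1 a2] := blockP y incU U0.
have /andP[b1 b2] := blockP (block U y) incV V0.
have c1 := strictly_increasing_le incU b1.
have c2 := strictly_increasing_le incU b2.
move: c1 c2; rewrite !UV; set w := block V _ => c1 c2.
have : (w <= y %/ M)%N by rewrite leq_divRL // mulnC; lia.
have : (y %/ M < w.+1)%N by rewrite ltn_divLR // mulnC; lia.
lia.
Qed.

(* Splits M evenly over each block of V. *)
Definition refine M V y :=
  let x := block V y in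
  (M * x + ((y - V x) * M) %/ (V x.+1 - V x))%N.

Lemma refineE M V x t : strictly_increasing V -> V 0 = 0 ->
  (t <= V x.+1 - V x)%N ->
  refine M V (V x + t) = (M * x + (t * M) %/ (V x.+1 - V x))%N.
Proof.
move=> incV V0; rewrite leq_eqVlt => /predU1P[->|tlt]; last first.
  by rewrite /refine (@block_unique V x) ?addKn //; lia.
have lt := incV x.
rewrite subnKC ?(ltnW lt) // /refine (@block_unique V x.+1) ?leqnn ?incV //.
rewrite subnn mul0n div0n addn0 mulKn ?subn_gt0 //; lia.
Qed.

Lemma refine_comp M V b : strictly_increasing V -> V 0 = 0 ->
  refine M V (V b) = (M * b)%N.
Proof.
by move=> incV V0; rewrite -[V b]addn0 refineE // mul0n div0n addn0.
Qed.

Lemma refine0 M V : strictly_increasing V -> V 0 = 0 -> refine M V 0 = 0.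
Proof. by move=> incV V0; rewrite -{1}V0 refine_comp // muln0. Qed.

(** Cutting M at the integer parts of t M / c gives pieces whose lengths are M / c rounded down or
    up, hence between a and b as soon as a c <= M <= b c. *)
Lemma refine_steps M V lo hi a b : strictly_increasing V -> V 0 = 0 ->
    (forall x, V x + lo <= V x.+1 <= V x + hi)%N ->
    (forall c, lo <= c <= hi -> a * c <= M <= b * c)%N ->
  forall y, (refine M V y + a <= refine M V y.+1 <= refine M V y + b)%N.
Proof.
move=> incV V0 stepV Mc y.
have /andP[h1 h2] := blockP y incV V0.
set x := block V y in h1 h2.
have [c0 Mc'] : (0 < V x.+1 - V x)%N /\
  (a * (V x.+1 - V x) <= M <= b * (V x.+1 - V x))%N.
  split; [by have := incV x; lia | by apply: Mc; have := stepV x; lia].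
have {1 4}-> : y = (V x + (y - V x))%N by lia.
have -> : y.+1 = (V x + (y - V x).+1)%N by lia.
rewrite !refineE //; try lia.
set c := (V x.+1 - V x)%N in c0 Mc' *; set t := (y - V x)%N.
rewrite mulSn -!addnA !leq_add2l.
have /andP[ac cb] := Mc'.
apply/andP; split.
  by rewrite leq_divRL // mulnDl; have := leq_divM (t * M) c; lia.
rewrite -ltnS ltn_divLR // mulSn mulnDl.
by have := ltn_ceil (t * M) c0; lia.
Qed.

Lemma refine_local M V V' B y : strictly_increasing V -> V 0 = 0 ->
    strictly_increasing V' -> V' 0 = 0 ->
    (forall b, b <= B -> V b = V' b)%N -> (y <= V B)%N ->
  refine M V y = refine M V' y.
Proof.
move=> incV V0 incV' V'0 VV'; rewrite leq_eqVlt => /predU1P[->|yB].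
  by rewrite refine_comp // VV' // refine_comp.
have /andP[h1 h2] := blockP y incV V0.
have xB : (block V y < B)%N.
  rewrite ltnNge; apply/negP => Bx.
  by have := strictly_increasing_le incV Bx; lia.
have e : block V' y = block V y.
  by apply: block_unique => //; rewrite -!VV' ?h1 // ltnW.
by rewrite /refine e !VV' // ltnW.
Qed.

End Blocks.

(** * Trees with prescribed numbers of grandchildren *)

Section Tower.
Variables (M a b c : nat -> nat).
Hypothesis a_gt0 : forall i, (0 < a i)%N.
Hypothesis a_gt1 : forall i, (1 < a i.+1)%N.
Hypothesis c_bounds : forall i, (a i <= c i <= b i)%N.
Hypothesis M_bounds :
  forall i k, (a i.+1 <= k <= b i.+1 -> a i * k <= M i <= b i * k)%N.
Hypothesis M_div : forall i, (M i %/ c i.+1)%N = c i.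

Fixpoint approx d i : nat -> nat :=
  if d is d'.+1 then refine (M i) (approx d' i.+1) else fun x => (c i * x)%N.

Lemma approx_spec d i : [/\ strictly_increasing (approx d i), approx d i 0 = 0
  & forall x, approx d i x + a i <= approx d i x.+1 <= approx d i x + b i]%N.
Proof.
elim: d i => [|d IHd] i.
  split=> [x||x] /=; rewrite ?muln0 // mulnS; have := c_bounds i;
  have := a_gt0 i; lia.
have [incV V0 stepV] := IHd i.+1.
have s := refine_steps incV V0 stepV (@M_bounds i).
split=> //; last exact: refine0.
by move=> x /=; have := s x; have := a_gt0 i; lia.
Qed.

(* [approx d i] and [approx d' i] agree on [0, horizon d i] for d <= d'. *)
Fixpoint horizon d i :=
  if d is d'.+1 then approx d' i.+1 (horizon d' i.+1) else 1%N.

(** Blocks above the lowest level have length at least 2, so the horizon at least doubles with each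
    unit of depth. *)
Lemma horizon_gt d i : (d < horizon d i)%N.
Proof.
elim: d i => // d IHd i /=; have [inc A0 step] := approx_spec d i.+1.
suff : (2 * horizon d i.+1 <= approx d i.+1 (horizon d i.+1))%N.
  by have := IHd i.+1; lia.
elim: (horizon _ _) => // x IHx; have := step x; have := a_gt1 i; lia.
Qed.

(** The first of the c_(i+1) pieces of M_i has length M_i / c_(i+1) rounded down, which is c_i by
    [M_div]. This value, common to all depths, starts the agreement between truncated towers. *)
Lemma approx1 d i : approx d i 1 = c i.
Proof.
elim: d i => [|d IHd] i /=; first by rewrite muln1.
have [inc A0 _] := approx_spec d i.+1.
have c0 : (0 < c i.+1)%N by have := c_bounds i.+1; have := a_gt0 i.+1; lia.
have := @refineE (M i) (approx d i.+1) 0 1 inc A0.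
by rewrite A0 IHd add0n muln0 add0n mul1n subn0 => -> //.
Qed.

(** If two versions of a level agree up to B, then by [refine_local] their refinements agree up to
    the first child of B; [horizon] iterates this. *)
Lemma approx_stableS d i x :
  (x <= horizon d i)%N -> approx d.+1 i x = approx d i x.
Proof.
elim: d i x => [|d IHd] i x.
  case: x => [|[|//]] _; last by rewrite !approx1.
  by have [_ -> _] := approx_spec 1 i; rewrite /= muln0.
move=> xh; have [inc A0 _] := approx_spec d i.+1.
have [inc' A0' _] := approx_spec d.+1 i.+1.
rewrite [LHS]/= -/(approx d.+1 i.+1) [RHS]/=; apply/esym.
apply: (@refine_local _ _ _ (horizon d i.+1)) => // y yh.
by rewrite IHd.
Qed.

Lemma approx_stable d d' i x :
  (x <= d <= d')%N -> approx d' i x = approx d i x.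
Proof.
elim: d' => [|d' IHd'] h; first by have -> : d = 0%N by lia.
have [->//|dd'] := eqVneq d d'.+1.
rewrite approx_stableS ?IHd' //; first lia.
by have := horizon_gt d' i; lia.
Qed.

(* The nodes of each level are numbered from the left, and [tower i] sends a
   node of level i + 1 to its first child, at level i. *)
Definition tower i x := approx x i x.

Lemma tower_spec i : [/\ strictly_increasing (tower i), tower i 0 = 0
  & forall x, tower i (tower i.+1 x) = (M i * x)%N].
Proof.
split=> [x||x].
- rewrite /tower -(@approx_stable x x.+1 i x) ?leqnn ?leqnSn //.
  by have [inc _ _] := approx_spec x.+1 i; exact: inc.
- by rewrite /tower /= muln0.
- rewrite /tower; set y := approx x i.+1 x.
  have xy : (x <= y)%N.
    by have [inc _ _] := approx_spec x i.+1; exact: (strictly_increasing_ge_id x inc).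
  have [inc A0 _] := approx_spec y i.+1.
  rewrite -(@approx_stable y y.+1 i y) ?leqnn ?leqnSn //=.
  by rewrite {2}/y -(@approx_stable x y i.+1 x) ?leqnn ?xy // refine_comp.
Qed.

End Tower.

Definition place_values (p : nat -> nat) :=
  [/\ p 0 = 1, forall j, p j %| p j.+1, forall j, 0 < p j
    & forall B, exists j, B <= p j]%N.

Lemma place_values_dvd p j k :
  place_values p -> (p j <= p k)%N -> p j %| p k.
Proof.
case=> _ pdvd p0 _; have mono i l : (i <= l)%N -> p i %| p l.
  by move/subnK <-; elim: (l - i)%N => // d IHd; exact: dvdn_trans IHd (pdvd _).
case: (leqP j k) => [/mono//|/ltnW/mono kj] jk.
by have -> // : p j = p k by apply/eqP; rewrite eqn_leq jk dvdn_leq.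
Qed.

Lemma divn_divnK m d : (0 < d)%N -> (d * d <= m)%N -> (m %/ (m %/ d))%N = d.
Proof.
move=> d0 hm; have q : (d <= m %/ d)%N by rewrite leq_divRL.
have /andP[h1 h2] : (m %/ d * d <= m < (m %/ d).+1 * d)%N.
  by rewrite leq_divM ltn_ceil.
have [//|q0] := posnP (m %/ d); first lia.
apply/eqP; rewrite eqn_leq leq_divRL // [(d * _)%N]mulnC h1 andbT.
rewrite -ltnS ltn_divLR //; nia.
Qed.

(** * Interleaving two sequences of place values *)

Section Interleaving.
Variable X : bool -> nat -> nat.
Hypothesis Xpv : forall e, place_values (X e).

Let Xunb e B : exists j, (B <= X e j)%N. Proof. by have [] := Xpv e. Qed.

(* (a, c, b, w, w'): bounds a <= c <= b on block lengths, the length c of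
   the first block, and the next two place values, taken alternately from the
   two systems. *)
Fixpoint state i : nat * nat * nat * nat * nat :=
  if i is i'.+1 then
    let: (a, c, b, w, w') := state i' in
    let w'' := X (odd i') (ex_minn (Xunb (odd i') (w * (2 * b * c)))) in
    let M := (w'' %/ w)%N in ((M %/ b).+1, M %/ c, M %/ a, w', w'')%N
  else (1, 2, 3, 1, 1)%N.

Let a i := (state i).1.1.1.1.
Let c i := (state i).1.1.1.2.
Let b i := (state i).1.1.2.
Let W i := (state i).1.2.
Let M i := (W i.+2 %/ W i)%N.

Let stateS i : [/\ a i.+1 = (M i %/ b i).+1, c i.+1 = M i %/ c i,
  b i.+1 = M i %/ a i & W i * (2 * b i * c i) <= W i.+2]%N.
Proof.
rewrite /a /b /c /M /W /=; case: (state i) => [[[[a' c'] b'] w] w'] /=.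
by case: ex_minnP.
Qed.

Let W_in i : exists k, W i = X (odd i) k.
Proof.
case: i => [|[|i]]; try by exists 0; have [] := Xpv false; have [] := Xpv true.
rewrite /W /= negbK; case: (state i) => [[[[a' c'] b'] w] w'] /=.
by exists (ex_minn (Xunb (odd i) (w * (2 * b' * c')))).
Qed.

Let W_gt0 i : (0 < W i)%N.
Proof. by have [k ->] := W_in i; have [_ _ ->] := Xpv (odd i). Qed.

(** The factor 2 in M_i >= 2 b_i c_i makes M_i / c_i - M_i / b_i and M_i / a_i - M_i / c_i at least
    2, so rounding preserves the strict order, even with the extra 1 in a_(i+1). *)
Let inv i : (0 < a i /\ a i < c i /\ c i < b i)%N.
Proof.
elim: i => // i [a0 [ac cb]]; have [-> -> -> hW] := stateS i.
have hM : (2 * b i * c i <= M i)%N by rewrite leq_divRL // mulnC.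
move: (a i) (b i) (c i) (M i) a0 ac cb hM => a' b' c' M' a0 ac cb hM.
have /andP[h1 h2] : (M' %/ b' * b' <= M' < (M' %/ b').+1 * b')%N
  by rewrite leq_divM ltn_ceil //; lia.
have /andP[h3 h4] : (M' %/ c' * c' <= M' < (M' %/ c').+1 * c')%N
  by rewrite leq_divM ltn_ceil //; lia.
have /andP[h5 h6] : (M' %/ a' * a' <= M' < (M' %/ a').+1 * a')%N
  by rewrite leq_divM ltn_ceil //; lia.
split=> //; split.
  rewrite leq_divRL; last lia.
  have : ((M' %/ b').+2 * c' * b' <= M' * b')%N; last by rewrite leq_pmul2r //; lia.
  by have : (M' %/ b' * b' * c' <= M' * c')%N; [rewrite leq_pmul2r //; lia | nia].
rewrite leq_divRL //.
have : ((M' %/ c').+1 * a' * c' <= M' * c')%N; last by rewrite leq_pmul2r //; lia.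
have : (M' %/ c' * c' * a' <= M' * a')%N; [rewrite leq_pmul2r //; lia | nia].
Qed.

Let M_ge i : (2 * b i * c i <= M i)%N.
Proof. by have [_ _ _ hW] := stateS i; rewrite leq_divRL // mulnC. Qed.

Let a_gt0 i : (0 < a i)%N. Proof. by have [] := inv i. Qed.

Let a_gt1 i : (1 < a i.+1)%N.
Proof.
have [-> _ _ _] := stateS i; rewrite ltnS divn_gt0; have := inv i; last lia.
have := M_ge i; nia.
Qed.

Let c_bounds i : (a i <= c i <= b i)%N.
Proof. have := inv i; lia. Qed.

Let M_bounds i k : (a i.+1 <= k <= b i.+1 -> a i * k <= M i <= b i * k)%N.
Proof.
have [-> _ -> _] := stateS i => /andP[h1 h2]; have [a0 [ac cb]] := inv i.
rewrite leq_divRL // in h2; rewrite mulnC h2 /= mulnC.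
have := @ltn_ceil (M i) (b i); rewrite -(leq_pmul2r (_ : 0 < b i)%N) in h1; lia.
Qed.

Let M_div i : (M i %/ c i.+1)%N = c i.
Proof.
have [_ -> _ _] := stateS i; have [a0 [ac cb]] := inv i.
have hM := M_ge i.
by apply: divn_divnK; nia.
Qed.

Let U := tower M c.

Let U_spec i : [/\ strictly_increasing (U i), U i 0 = 0
  & forall x, U i (U i.+1 x) = (M i * x)%N].
Proof. exact: tower_spec a_gt0 a_gt1 c_bounds M_bounds M_div i. Qed.

Let W_le i : (2 * W i <= W i.+2)%N.
Proof.
have [_ _ _] := stateS i; apply: leq_trans; rewrite mulnC leq_pmul2l //.
by rewrite -mulnA leq_pmulr // muln_gt0; have := inv i; lia.
Qed.

Let W_dvd i : W i.+2 = (W i * M i)%N.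
Proof.
rewrite mulnC divnK //; have [k e] := W_in i; have [k' e'] := W_in i.+2.
have := W_le i; rewrite e e' /= negbK => h.
by apply: (place_values_dvd (Xpv _)); lia.
Qed.

Fixpoint ancestor i x :=
  if i is i'.+1 then block (U i') (ancestor i' x) else x.

(** By [block_comp], two steps up divide by M_i = W_(i+2) / W_i. Since W_0 = W_1 = 1, even levels
    are quotients of x and odd levels quotients of [ancestor 1 x]. The step of two explains the
    induction on pairs of consecutive levels. *)
Let ancestorE i x :
  ancestor i x = ((if odd i then ancestor 1 x else x) %/ W i)%N.
Proof.
suff [] : ancestor i x = ((if odd i then ancestor 1 x else x) %/ W i)%N /\
  ancestor i.+1 x = ((if odd i.+1 then ancestor 1 x else x) %/ W i.+1)%N by [].
elim: i => [|i [IH1 IH2]]; first by rewrite /= !divn1.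
split=> //; have [inc U0 UU] := U_spec i; have [inc' U0' _] := U_spec i.+1.
rewrite W_dvd divnMA [odd i.+2]/= negbK -IH1.
have M0 : (0 < M i)%N.
  by apply: leq_trans (M_ge i); have := inv i; rewrite !muln_gt0 /=; lia.
exact: (block_comp _ inc U0 inc' U0' M0 UU).
Qed.

Let W_double_ge i : (i < W i.*2 /\ i < W i.*2.+1)%N.
Proof.
elim: i => // i [h1 h2]; rewrite doubleS.
by have := W_le i.*2; have := W_le i.*2.+1; lia.
Qed.

Let W_cofinal e j : exists2 i, odd i = e & X e j %| W i.
Proof.
exists (e + (X e j).*2)%N; first by rewrite oddD odd_double addbF; case: (e).
have [k Wk] := W_in (e + (X e j).*2).
have oe : odd (e + (X e j).*2) = e by rewrite oddD odd_double addbF; case: (e).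
rewrite Wk oe; apply: (place_values_dvd (Xpv e)); rewrite -[in X in (_ <= X)%N]oe -Wk.
by have := W_double_ge (X e j); case: (e) => -[]; rewrite ?add1n ?add0n; lia.
Qed.

Let eq_divn_dvd d e x y : d %| e -> (x %/ d = y %/ d -> x %/ e = y %/ e)%N.
Proof. by move=> /dvdnP[m ->]; rewrite mulnC !divnMA => ->. Qed.

(** The map is [ancestor 1]. Quotients of x by the first system are even ancestors, quotients of its
    image by the second are odd ancestors, and each ancestor determines the next one. *)
Lemma interleaving_coarse : exists h : nat -> nat,
  [/\ forall y, exists x, h x = y,
      forall j, exists l, forall x y,
        (x %/ X false j = y %/ X false j -> h x %/ X true l = h y %/ X true l)%N
    & forall l, exists j, forall x y,
        (h x %/ X true l = h y %/ X true l -> x %/ X false j = y %/ X false j)%N].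
Proof.
have key i x y : ancestor i x = ancestor i y -> ancestor i.+1 x = ancestor i.+1 y.
  by move=> /= ->.
exists (ancestor 1); split=> [y|j|l].
- exists (U 0 y); have [inc U0 _] := U_spec 0.
  by apply: block_unique => //; rewrite leqnn inc.
- have [i oi di] := W_cofinal false j; have [k Wk] := W_in i.+1.
  exists k => x y /(eq_divn_dvd di) e;
    rewrite oddS oi in Wk; rewrite -Wk.
  by have := key i x y; rewrite (ancestorE i) (ancestorE i y) (ancestorE i.+1)
    (ancestorE i.+1 y) oddS oi => /(_ e).
- have [i oi di] := W_cofinal true l; have [k Wk] := W_in i.+1.
  exists k => x y /(eq_divn_dvd di) e;
    rewrite oddS oi in Wk; rewrite -Wk.
  by have := key i x y; rewrite (ancestorE i) (ancestorE i y) (ancestorE i.+1)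
    (ancestorE i.+1 y) oddS oi => /(_ e).
Qed.

End Interleaving.

Lemma place_values_coarse p q : place_values p -> place_values q ->
  exists h : nat -> nat,
  [/\ forall y, exists x, h x = y,
      forall j, exists l, forall x y,
        (x %/ p j = y %/ p j -> h x %/ q l = h y %/ q l)%N
    & forall l, exists j, forall x y,
        (h x %/ q l = h y %/ q l -> x %/ p j = y %/ p j)%N].
Proof.
by move=> pp qq; apply: (@interleaving_coarse (fun e => if e then q else p)); case.
Qed.

Local Open Scope ring_scope.

(** * A discrete Poincare-Miranda theorem *)

Section Cube.
Variables (n : nat) (K : comNzRingType).
Hypothesis char2 : forall x : K, x + x = 0.

Let addr_eq0_char2 (x y : K) : x + y = 0 -> x = y.
Proof. by move=> xy; rewrite -[x]addr0 -(char2 y) addrA xy add0r. Qed.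

Lemma sum_offdiag_sym (S : {set 'I_n}) (f : 'I_n -> 'I_n -> K) :
  (forall s t, f s t = f t s) -> \sum_(s in S) \sum_(t in S :\ s) f s t = 0.
Proof.
move=> fC.
have -> : \sum_(s in S) \sum_(t in S :\ s) f s t =
    \sum_(s in S) \sum_(t in S | (s < t)%N) f s t +
    \sum_(s in S) \sum_(t in S | (t < s)%N) f s t.
  rewrite -big_split /=; apply: eq_bigr => s sS.
  rewrite (bigID (fun t : 'I_n => (s < t)%N)) /=; congr (_ + _);
    apply: eq_bigl => t; rewrite !inE; case: (t \in S); rewrite ?andbF //=;
    rewrite -val_eqE /=; lia.
rewrite [X in _ + X](exchange_big_dep (fun t => t \in S)) /=; last first.
  by move=> s t _ /andP[].
rewrite -[RHS](char2 (\sum_(s in S) \sum_(t in S | (s < t)%N) f s t)).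
congr (_ + _); apply: eq_bigr => t tS; apply: eq_big => [s|s _]; last exact: fC.
by rewrite tS.
Qed.

Lemma exchange_offdiag (S : {set 'I_n}) (f : 'I_n -> 'I_n -> K) :
  \sum_(s in S) \sum_(t in S :\ s) f s t =
  \sum_(t in S) \sum_(s in S :\ t) f s t.
Proof.
rewrite (exchange_big_dep (fun t => t \in S)) /=; last first.
  by move=> s t _; rewrite inE => /andP[].
apply: eq_bigr => t tS; apply: eq_bigl => s.
by rewrite !inE tS andbT andbC eq_sym.
Qed.

Section Product.
Variables (T : zmodType) (e : 'I_n -> T) (alpha : nat -> T -> 'I_n -> K).

Definition corner (S : {set 'I_n}) : T := \sum_(s in S) e s.

Lemma cornerD1 (S : {set 'I_n}) s : s \in S -> corner S = e s + corner (S :\ s).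
Proof. by move=> sS; rewrite /corner (big_setD1 s). Qed.

(* The sum, over all monotone lattice paths from v to v + corner S, of the
   product of the values of alpha_0, ..., alpha_(m-1) along the path. *)
Fixpoint path_sum m (S : {set 'I_n}) (v : T) : K :=
  if m is m'.+1 then
    \sum_(s in S) path_sum m' (S :\ s) v * alpha m' (v + corner (S :\ s)) s
  else 1.

Lemma path_sum_eq0 k m (S : {set 'I_n}) v : (k < m)%N ->
  (forall (R : {set 'I_n}) s, s \notin R -> alpha k (v + corner R) s = 0) ->
  path_sum m S v = 0.
Proof.
move=> km al0; elim: m S km => // m IHm S; rewrite ltnS leq_eqVlt /=.
case/predU1P => [<-|km]; rewrite big1 // => s _.
  by rewrite al0 ?mulr0 // !inE eqxx.
by rewrite IHm ?mul0r.
Qed.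

Hypothesis closed : forall k v s t,
  alpha k v s + alpha k (v + e s) t = alpha k v t + alpha k (v + e t) s.

(* Stokes' formula on the cube with edges in S, in characteristic 2. *)
Lemma path_sum_boundary m (S : {set 'I_n}) v :
  \sum_(s in S) path_sum m (S :\ s) v =
  \sum_(s in S) path_sum m (S :\ s) (v + e s).
Proof.
elim: m S => [|m IHm] S; first by [].
have DC (s t : 'I_n) : S :\ s :\ t = S :\ t :\ s by rewrite !finset.setDDl finset.setUC.
(* X moves only the last factor by [e s]; the induction hypothesis will move the first m. *)
pose X := \sum_(s in S) \sum_(t in S :\ s)
  path_sum m (S :\ s :\ t) v * alpha m (v + e s + corner (S :\ s :\ t)) t.
transitivity X.
  (* Closedness of alpha_m on the square spanned by s and t makes the summand symmetric in s and t,
     so the terms cancel in pairs. *)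
  apply: addr_eq0_char2; rewrite /X -big_split /=.
  under eq_bigr do rewrite -big_split /=.
  apply: (@sum_offdiag_sym _ (fun s t => path_sum m (S :\ s :\ t) v *
    alpha m (v + corner (S :\ s :\ t)) t + path_sum m (S :\ s :\ t) v *
    alpha m (v + e s + corner (S :\ s :\ t)) t)) => s t.
  rewrite -!mulrDr (DC t); congr (_ * _); rewrite ![v + e _ + _]addrAC.
  apply: addr_eq0_char2.
  by rewrite [X in X + _]addrC addrACA [X in X + _]addrC closed.
have X_E w : \sum_(s in S) \sum_(t in S :\ s)
    path_sum m (S :\ s :\ t) (w s) * alpha m (v + e s + corner (S :\ s :\ t)) t =
  \sum_(t in S) (\sum_(s in S :\ t) path_sum m (S :\ t :\ s) (w s)) *
    alpha m (v + corner (S :\ t)) t.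
  rewrite exchange_offdiag; apply: eq_bigr => t tS; rewrite mulr_suml.
  by apply: eq_bigr => s sS; rewrite DC -addrA -cornerD1.
rewrite /X (X_E (fun=> v)); under eq_bigr do rewrite IHm.
by rewrite -(X_E (fun s => v + e s)).
Qed.

End Product.
End Cube.

Lemma addFpp2 (x : 'F_2) : x + x = 0.
Proof. by apply/val_inj; case: x => -[|[|]]. Qed.

(** * Integration modulo 2 over a discrete torus *)

Section Torus.
Variables (n N : nat).
Local Notation T := 'rV['I_N.+2]_n.
Variable F : 'I_n -> T -> bool.
Hypothesis F0 : forall k (v : T), v 0 k = 0 -> F k v = false.
Hypothesis F1 : forall k (v : T), v 0 k = ord_max -> F k v = true.

Let e (i : 'I_n) : T := delta_mx 0 i.

Let corner_coord S i : corner e S 0 i = (i \in S)%:R.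
Proof.
rewrite /corner summxE; under eq_bigr do rewrite mxE eqxx /= eq_sym.
case: (boolP (i \in S)) => [iS|niS]; last first.
  by rewrite big1 // => j jS; case: eqP jS niS => // -> ->.
by rewrite (bigD1 i) //= eqxx big1 ?addr0 // => j /andP[_ /negPf ->].
Qed.

Let wall (k : nat) (v : T) (s : 'I_n) : 'F_2 :=
  ((s == k :> nat) && (v 0 s == ord_max))%:R.

Let f (k : nat) (v : T) : 'F_2 :=
  if insub k is Some k' then (F k' v)%:R else 0.

(* Cohomologous to the class dual to the hyperplane v_k = 0 of the torus. *)
Let alpha k v s : 'F_2 := f k (v + e s) + f k v + wall k v s.

Let wall_shift k (v : T) s t : s != t -> wall k (v + e s) t = wall k v t.
Proof.
by move=> st; rewrite /wall mxE [delta_mx _ _ _ _]mxE [t == s]eq_sym (negPf st) andbF addr0.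
Qed.

Let alpha_closed k v s t :
  alpha k v s + alpha k (v + e s) t = alpha k v t + alpha k (v + e t) s.
Proof.
have [->//|st] := eqVneq s t.
rewrite /alpha !wall_shift // 1?eq_sym // [v + e t + e s]addrAC.
set w1 := wall _ _ _; set w2 := wall _ _ _.
set f1 := f _ _; set f2 := f _ _; set f3 := f _ _; set f4 := f _ _.
have -> : f1 + f2 + w1 + (f3 + f1 + w2) = (f1 + f1) + (f2 + f3 + w1 + w2) by ring.
have -> : f4 + f2 + w2 + (f3 + f4 + w1) = (f4 + f4) + (f2 + f3 + w1 + w2) by ring.
by rewrite !addFpp2.
Qed.

Let slab m := [pred v : T | [forall k : 'I_n, (m <= k)%N ==> (v 0 k == ord_max)]].

Let initial m := [set k : 'I_n | (k < m)%N].

(** The integral of the product of alpha_0, ..., alpha_(m-1) over the m-dimensional subtorus where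
    the other coordinates equal [ord_max]. *)
Let A m : 'F_2 := \sum_(v | slab m v) path_sum e alpha m (initial m) v.

Let slab_shift m (s : 'I_n) v : (s < m)%N -> slab m (v + e s) = slab m v.
Proof.
move=> sm; apply: eq_forallb => k; case: (leqP m k) => //= mk.
have -> : (v + e s) 0 k = v 0 k; last by [].
rewrite !mxE eqxx /=; have -> : (k == s) = false by rewrite -val_eqE /=; lia.
by rewrite addr0.
Qed.

(** Split alpha_m into [wall] and the coboundary of f. The wall term keeps only the cubes with v_m =
    [ord_max], that is, [slab m]. The two halves of the coboundary term cancel modulo 2 by summation
    by parts: after a translation by [e s] in one of them, [path_sum_boundary] identifies them. *)
Let A_step (m : 'I_n) : A m.+1 = A m.
Proof.
set S := initial m.+1.
have mS : m \in S by rewrite inE.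
have SDm : S :\ m = initial m.
  by apply/setP => k; rewrite !inE ltnS ltn_neqAle -val_eqE.
have corner_m : corner e (S :\ m) 0 m = 0 by rewrite corner_coord !inE eqxx.
pose P s v := path_sum e alpha m (S :\ s) v.
have split_sum v : path_sum e alpha m.+1 S v =
    (P m v * (v 0 m == ord_max)%:R + \sum_(s in S) P s v * f m (v + corner e S))
    + \sum_(s in S) P s v * f m (v + corner e (S :\ s)).
  rewrite /= -/(P _ _).
  transitivity (\sum_(s in S) (P s v * wall m (v + corner e (S :\ s)) s +
    (P s v * f m (v + corner e S) + P s v * f m (v + corner e (S :\ s))))).
    apply: eq_bigr => s sS; rewrite -!mulrDr -/(P s v) /alpha; congr (_ * _).
    by rewrite addrC -[v + _ + e s]addrA [_ + e s]addrC -cornerD1.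
  rewrite !big_split /= addrA; congr (_ + _ + _).
  rewrite (bigD1 m) //= big1 ?addr0; last first.
    by move=> s /andP[_ /negPf sm]; rewrite /wall val_eqE sm mulr0.
  by rewrite /wall eqxx /= mxE corner_m addr0.
rewrite /A (eq_bigr _ (fun v _ => split_sum v)) !big_split /= -addrA.
have -> : \sum_(v | slab m.+1 v) \sum_(s in S) P s v * f m (v + corner e (S :\ s))
   = \sum_(v | slab m.+1 v) \sum_(s in S) P s v * f m (v + corner e S).
  rewrite exchange_big /=.
  transitivity (\sum_(v | slab m.+1 v)
      (\sum_(s in S) P s (v + e s)) * f m (v + corner e S)).
    under [RHS]eq_bigr do rewrite mulr_suml.
    rewrite [RHS]exchange_big /=; apply: eq_bigr => s sS.
    rewrite (reindex_inj (addIr (e s))) /=; apply: eq_big => [v|v _].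
      by apply: slab_shift; move: sS; rewrite inE.
    by rewrite -addrA -cornerD1.
  apply: eq_bigr => v _; rewrite /P -mulr_suml.
  by rewrite -(@path_sum_boundary _ _ addFpp2 _ _ _ alpha_closed).
rewrite addFpp2 addr0 -SDm.
have slabE v : slab m v = slab m.+1 v && (v 0 m == ord_max).
  apply/forallP/andP => [h|[/forallP h vm] k].
    by split; [apply/forallP => k; apply/implyP => /ltnW; apply/implyP
              |have := h m; rewrite leqnn].
  rewrite leq_eqVlt; have [mk|mk] /= := eqVneq (m : nat) k; last exact: h.
  by rewrite -(val_inj mk).
rewrite (eq_bigl _ _ slabE) [RHS]big_mkcondr; apply: eq_bigr => v _.
by case: (_ == _); rewrite ?mulr1 ?mulr0.
Qed.

(** The integral over the whole torus is A n = A 0 = 1, so on some cube no alpha_k vanishes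
    identically. If that cube wrapped around in direction k, alpha_k would vanish on it: along k the
    jump of F_k from true to false is cancelled by [wall], and in the other directions F_k is
    constant. Without wrapping, alpha_k is the coboundary of F_k on the cube, so F_k is not constant
    there. *)
Lemma torus_hex : exists v : T,
  (forall k, v 0 k != ord_max) /\
  (forall k, exists R S : {set 'I_n}, F k (v + corner e R) != F k (v + corner e S)).
Proof.
have A0 : A 0 = 1.
  rewrite /A (big_pred1 (const_mx ord_max)) // => v; apply/forallP/eqP => [h|-> k].
    by apply/rowP => k; rewrite mxE; have := h k => /eqP.
  by rewrite mxE eqxx.
have An m : (m <= n)%N -> A m = 1.
  elim: m => // m IHm mn; rewrite (A_step (Ordinal mn)) /= IHm //; exact: ltnW.
suff hex : [exists v : T, [forall k, v 0 k != ord_max] && [forall k : 'I_n,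
    [exists R : {set 'I_n}, [exists S : {set 'I_n},
    F k (v + corner e R) != F k (v + corner e S)]]]].
  have /existsP[v /andP[/forallP v1 /forallP v2]] := hex; exists v; split=> // k.
  by have /existsP[R /existsP[S RS]] := v2 k; exists R, S.
apply: contraT => nohex; have := An n (leqnn n).
rewrite /A big1 => [/eqP//|v _].
suff [k al0] : exists k : 'I_n, forall (R : {set 'I_n}) s, s \notin R ->
    alpha k (v + corner e R) s = 0.
  exact: (@path_sum_eq0 _ _ _ _ _ k).
have fE (k : 'I_n) w : f k w = (F k w)%:R by rewrite /f valK.
case: (boolP [exists k, v 0 k == ord_max]) => [/existsP[k /eqP vk]|nmax].
  exists k => R s sR; rewrite /alpha !fE /wall val_eqE.
  have vR : (v + corner e R) 0 k = ord_max + (k \in R)%:R.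
    by rewrite mxE corner_coord vk.
  have max1 : ord_max + 1 = 0 :> 'I_N.+2.
    by apply/val_inj; rewrite /= addn1 modnn.
  have [sk|sk] /= := eqVneq s k.
    rewrite sk in sR *; rewrite (negPf sR) addr0 in vR.
    rewrite vR eqxx F0 ?F1 //= ?addr0 ?addFpp2 ?add0r ?addFpp2 //.
    by rewrite mxE vR mxE !eqxx.
  have -> : F k (v + corner e R + e s) = F k (v + corner e R).
    have ek : (v + corner e R + e s) 0 k = (v + corner e R) 0 k.
      by rewrite [LHS]mxE [X in _ + X]mxE eqxx /= eq_sym (negPf sk) addr0.
    move: vR; case: (k \in R); rewrite ?addr0 ?max1 => vR; last by rewrite !F1 ?ek.
    by rewrite !F0 ?ek.
  by rewrite addr0 addFpp2.
have vmax : [forall k, v 0 k != ord_max] by move: nmax; rewrite negb_exists.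
move: nohex; rewrite negb_exists => /forallP/(_ v); rewrite vmax /=.
rewrite negb_forall => /existsP[k]; rewrite negb_exists => /forallP const.
exists k => R s sR; rewrite /alpha !fE /wall val_eqE.
have /eqP <- : F k (v + corner e R) == F k (v + corner e R + e s).
  have := const R; rewrite negb_exists => /forallP/(_ (s |: R)).
  rewrite negbK (cornerD1 _ (finset.setU11 s R)) finset.setU1K //.
  by rewrite -[e s + _]addrC addrA.
rewrite addFpp2 add0r; case: eqP sR => //= -> kR.
by rewrite mxE corner_coord (negPf kR) addr0 (negPf (forallP vmax k)).
Qed.

Lemma torus_hex_nat : exists x : 'I_n -> nat,
  (forall k, x k <= N)%N /\
  (forall k, exists R S : {set 'I_n},
    F k (\row_i inord (x i + (i \in R))) != F k (\row_i inord (x i + (i \in S)))).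
Proof.
have [v [vmax vF]] := torus_hex.
exists (fun k => v 0 k); split=> k.
  by have := vmax k; have := ltn_ord (v 0 k); rewrite -val_eqE /=; lia.
have [R [S RS]] := vF k; exists R, S; move: RS; congr (F k _ != F k _);
  apply/rowP => i; apply/val_inj; rewrite /= !mxE corner_coord /=;
  have := vmax i; have := ltn_ord (v 0 i); rewrite -val_eqE /= => h1 h2;
  by rewrite inordK; case: (i \in _); rewrite /= ?modn_small; lia.
Qed.

End Torus.

Lemma hex n (N : nat) (F : 'I_n -> 'rV[int]_n -> bool) :
    (forall k (x : 'rV_n), x 0 k = 0 -> F k x = false) ->
    (forall k (x : 'rV_n), x 0 k = N.+1%:Z -> F k x = true) ->
  exists x : 'rV[int]_n, forall k, exists R S : {set 'I_n},
    F k (x + \row_i (i \in R)%:Z) != F k (x + \row_i (i \in S)%:Z).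
Proof.
move=> F0 F1.
pose G k (v : 'rV['I_N.+2]_n) := F k (\row_i (v 0 i)%:Z).
have [k v vk|k v vk|x [xN xF]] := @torus_hex_nat n N G.
- by apply: F0; rewrite mxE vk.
- by apply: F1; rewrite mxE vk.
exists (\row_i (x i)%:Z) => k; have [R [S RS]] := xF k; exists R, S.
move: RS; rewrite /G; congr (F k _ != F k _); apply/rowP => i;
  rewrite !mxE inordK ?PoszD //; have := xN i; case: (i \in _); lia.
Qed.

(** * Digits along a sequence of generators *)

Lemma int_subgroup_generator (P : int -> Prop) :
    P 0 -> (forall x y, P x -> P y -> P (x - y)) ->
  exists m : nat, forall z, P z <-> (m %| z)%Z.
Proof.
move=> P0 PB.
have PN x : P x -> P (- x) by move=> Px; rewrite -sub0r; exact: PB.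
have PD x y : P x -> P y -> P (x + y).
  by move=> Px /PN Py; rewrite -[y]opprK; exact: PB.
have PM x (z : int) : P x -> P (z * x).
  have PMn (n : nat) : P x -> P (n%:Z * x).
    move=> Px; elim: n => [|n IHn]; first by rewrite mul0r.
    by rewrite intS mulrDl mul1r; exact: PD.
  by case: z => n Px; rewrite ?NegzE ?mulNr; [exact: PMn|exact/PN/PMn].
have Pabs z : P z -> P `|z|%N.
  by move=> Pz; rewrite abszE; case: (ger0P z) => _ //; exact: PN.
have [[z Pz z0]|Pz] := pselect (exists2 z, P z & z != 0); last first.
  exists 0%N => z; rewrite dvd0z; split=> [Pz0|/eqP-> //].
  by apply/negPn/negP => z0; apply: Pz; exists z.
have ex : exists n : nat, `[< P n%:Z >] && (0 < n)%N.
  by exists `|z|%N; rewrite absz_gt0 z0 andbT; exact/asboolP/Pabs.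
case: (ex_minnP ex) => m /andP[/asboolP Pm m0] min; exists m => y; split=> [Py|].
  apply/dvdz_mod0P/eqP/negPn/negP => r0.
  have Pr : P (y %% m)%Z.
    by rewrite /modz; apply: PB => //; exact: PM.
  have : (m <= `|(y %% m)%Z|)%N.
    by apply: min; rewrite absz_gt0 r0 andbT; exact/asboolP/Pabs.
  have := modz_ge0 y (_ : m%:Z != 0); have := ltz_mod y (_ : m%:Z != 0); lia.
by case/dvdzP => q ->; exact: PM.
Qed.

(* An integer valued version of the distance to 0 for a proper invariant
   metric. *)
Definition proper_length (G : zmodType) (len : G -> nat) :=
  [/\ len 0 = 0%N, forall x, len (- x) = len x,
      forall x y, (len (x + y)%R <= len x + len y)%N
    & forall (s : G -> nat) r, exists K, forall x, (len x <= r -> s x <= K)%N].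

Section Length.
Variables (G : zmodType) (len : G -> nat).
Hypothesis len_proper : proper_length len.

Lemma lenMz x z : (len (x *~ z) <= `|z| * len x)%N.
Proof.
have [len0 lenN lenD _] := len_proper.
have lenMn n : (len (x *+ n) <= n * len x)%N.
  elim: n => [|n IHn]; first by rewrite mulr0n len0.
  by rewrite mulrSr mulSn addnC; apply: leq_trans (lenD _ _) _; rewrite leq_add2r.
by case: z => n /=; rewrite ?NegzE ?mulrNz ?lenN -?pmulrn; exact: lenMn.
Qed.

Lemma len_sum I (r : seq I) (f : I -> G) :
  (len (\sum_(i <- r) f i)%R <= \sum_(i <- r) len (f i))%N.
Proof.
have [len0 _ lenD _] := len_proper.
elim: r => [|i r IHr]; first by rewrite !big_nil len0.
by rewrite !big_cons; apply: leq_trans (lenD _ _) _; rewrite leq_add2l.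
Qed.

End Length.

Section Span.
Variables (G : zmodType) (g : nat -> G).

Fixpoint span k (x : G) : Prop :=
  if k is k'.+1 then exists z, span k' (x - g k' *~ z) else x = 0.

Lemma span0 k : span k 0.
Proof. by elim: k => // k IHk; exists 0; rewrite subr0. Qed.

Lemma spanB k x y : span k x -> span k y -> span k (x - y).
Proof.
elim: k x y => [|k IHk] x y /=; first by move=> -> ->; rewrite subr0.
move=> [z xz] [t yt]; exists (z - t).
rewrite mulrzBr opprB addrACA [- y - _]addrC addrACA -[X in _ + X]opprB.
exact: IHk.
Qed.

Lemma spanN k x : span k x -> span k (- x).
Proof. by move=> xk; rewrite -sub0r; apply: spanB xk; exact: span0. Qed.

Lemma spanD k x y : span k x -> span k y -> span k (x + y).
Proof. by move=> xk /spanN yk; rewrite -[y]opprK; exact: spanB. Qed.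

Lemma spanMz k x z : span k x -> span k (x *~ z).
Proof.
move=> xk; have xkn n : span k (x *+ n).
  by elim: n => [|n IHn]; [exact: span0 | rewrite mulrS; exact: spanD].
by case: z => n; rewrite ?NegzE ?mulrNz -?pmulrn; [|apply: spanN]; exact: xkn.
Qed.

Lemma spanS k x : span k x -> span k.+1 x.
Proof. by move=> xk; exists 0; rewrite subr0. Qed.

Lemma span_le k l x : (k <= l)%N -> span k x -> span l x.
Proof.
by move/subnK <-; elim: (l - k)%N => // d IHd /IHd; rewrite addSn; exact: spanS.
Qed.

Lemma span_gen k : span k.+1 (g k).
Proof. by exists 1; rewrite subrr; exact: span0. Qed.

Lemma span_sum k (c : nat -> int) : span k (\sum_(i < k) g i *~ c i).
Proof.
elim: k => [|k IHk]; first by rewrite big_ord0.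
by rewrite big_ord_recr /=; exists (c k); rewrite addrK.
Qed.

Lemma spanP k x : span k x -> exists c : nat -> int, x = \sum_(i < k) g i *~ c i.
Proof.
elim: k x => [|k IHk] x; first by move=> ->; exists (fun=> 0); rewrite big_ord0.
case=> z /IHk[c xc]; exists (fun i => if i == k then z else c i).
rewrite big_ord_recr /= eqxx -[LHS](subrK (g k *~ z)) xc; congr (_ + _).
by apply: eq_bigr => i _; have := ltn_ord i; case: eqP => // ->; rewrite ltnn.
Qed.

End Span.

Section Digits.
Variables (G : zmodType) (g : nat -> G) (m : nat -> nat).
Hypothesis span_full : forall x, exists k, span g k x.
Hypothesis m_order : forall k z, span g k (g k *~ z) <-> (m k %| z)%Z.

Lemma digit_sum_widen N k (c : nat -> int) : (k <= N)%N ->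
  (forall i, (k <= i)%N -> c i = 0) ->
  \sum_(i < N) g i *~ c i = \sum_(i < k) g i *~ c i.
Proof.
move=> kN c0; rewrite (big_ord_widen N (fun i => g i *~ c i) kN).
rewrite [RHS]big_mkcond; apply: eq_bigr => i _; case: ltnP => // ki.
by rewrite c0 ?mulr0z.
Qed.

(** Polynomials serve only as finitely supported sequences of digits. Where m i = 0 there is no
    condition, because z %% 0 = z. *)
Definition reduced (P : {poly int}) := forall i, (P`_i %% m i)%Z = P`_i.

Definition digits_value (P : {poly int}) : G := \sum_(i < size P) g i *~ P`_i.

Lemma digits_valueE N (P : {poly int}) : (size P <= N)%N ->
  digits_value P = \sum_(i < N) g i *~ P`_i.
Proof.
move=> PN; by rewrite (digit_sum_widen (c := fun i => P`_i) PN) // => i; exact: nth_default.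
Qed.

Lemma digits_valueB (P Q : {poly int}) : exists N, (size P <= N)%N /\ (size Q <= N)%N /\
  digits_value P - digits_value Q = \sum_(i < N) g i *~ (P`_i - Q`_i).
Proof.
exists (maxn (size P) (size Q)); rewrite leq_maxl leq_maxr; split=> //; split=> //.
rewrite (digits_valueE (leq_maxl _ (size Q))).
rewrite (digits_valueE (leq_maxr (size P) _)) -sumrB.
by apply: eq_bigr => i _; rewrite mulrzBr.
Qed.

(** The top coefficient is replaced by its remainder modulo m_k; the multiple of m_k that is left
    over contributes an element of [span g k]. *)
Lemma reduced_span k x : span g k x ->
  exists2 P, reduced P & (size P <= k)%N /\ x = \sum_(i < k) g i *~ P`_i.
Proof.
elim: k x => [|k IHk] x /=.
  move=> ->; exists 0; first by move=> i; rewrite coef0 mod0z.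
  by rewrite size_poly0 big_ord0.
case=> z xz; have : span g k (x - g k *~ (z %% m k)%Z).
  rewrite /modz mulrzBr opprB addrCA addrC; apply: spanD xz _.
  by apply/m_order; rewrite dvdz_mull.
case/IHk => P redP [Pk xP]; exists (P + (z %% m k)%Z *: 'X^k).
  move=> i; rewrite coefD coefZ coefXn; have [->|ik] := eqVneq i k.
    by rewrite nth_default // add0r mulr1 modz_mod.
  by rewrite mulr0 addr0.
split.
  apply: leq_trans (size_polyD _ _) _; rewrite geq_max (leqW Pk) /=.
  by apply: leq_trans (size_scale_leq _ _) _; rewrite size_polyXn.
rewrite big_ord_recr /= coefD coefZ coefXn eqxx mulr1 nth_default // add0r.
rewrite -[LHS](subrK (g k *~ (z %% m k)%Z)) xP; congr (_ + _).
apply: eq_bigr => i _; rewrite coefD coefZ coefXn.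
by have -> : (i == k :> nat) = false; [have := ltn_ord i; lia | rewrite mulr0 addr0].
Qed.

Lemma reduced_exists x : exists2 P, reduced P & digits_value P = x.
Proof.
have [k /reduced_span[P redP [Pk ->]]] := span_full x.
by exists P => //; exact: digits_valueE.
Qed.

Let small_digits (c : nat -> int) := forall i, m i = 0%N \/ (`|c i| < m i)%N.

Let reducedB P Q : reduced P -> reduced Q -> small_digits (fun i => P`_i - Q`_i).
Proof.
move=> redP redQ i; have [->|mi] := posnP (m i); [by left | right].
have m0 : (m i)%:Z != 0 by lia.
have := modz_ge0 P`_i m0; have := ltz_mod P`_i m0.
have := modz_ge0 Q`_i m0; have := ltz_mod Q`_i m0.
rewrite redP redQ; lia.
Qed.

(** The top term lies in the span of its predecessors, so m_N divides c_N; with |c_N| < m_N or m_N =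
    0, this forces c_N = 0. *)
Let small_digits_eq0 j N c : small_digits c ->
  span g j (\sum_(i < N) g i *~ c i) -> forall i, (j <= i < N)%N -> c i = 0.
Proof.
move=> smallc; elim: N => [|N IHN]; first by move=> _ i; rewrite andbF.
rewrite big_ord_recr /= => cj i /andP[ji iN].
have cN : c N = 0.
  have : span g N (g N *~ c N).
    rewrite -[_ *~ _](addKr (\sum_(i < N) g i *~ c i)) addrC.
    apply: spanB; last exact: span_sum.
    by apply: span_le cj; exact: leq_trans ji _.
  case/m_order/dvdzP => q cq; case: (smallc N) => [mN|]; first by rewrite cq mN mulr0.
  rewrite cq abszM absz_nat; have [->|] := eqVneq q 0; first by rewrite mul0r.
  by rewrite -absz_gt0; nia.
rewrite cN mulr0z addr0 in cj.
by move: iN; rewrite ltnS leq_eqVlt => /predU1P[->//|iN]; apply: IHN; rewrite ?ji.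
Qed.

Lemma digits_value_inj P Q : reduced P -> reduced Q ->
  digits_value P = digits_value Q -> P = Q.
Proof.
move=> redP redQ PQ; have [N [PN [QN e]]] := digits_valueB P Q.
apply/polyP => i; have [iN|Ni] := ltnP i N; last first.
  by rewrite !nth_default // (leq_trans _ Ni).
apply/eqP; rewrite -subr_eq0.
by rewrite (@small_digits_eq0 0 N _ (reducedB redP redQ)) // -e PQ subrr.
Qed.

Definition digits_near k (P Q : {poly int}) :=
  (forall i, (k <= i)%N -> P`_i = Q`_i) /\
  (forall i, (i < k)%N -> (`|(P`_i - Q`_i)%R| <= k)%N).

Variable len : G -> nat.
Hypothesis len_proper : proper_length len.

Lemma digits_value_bornologous k : exists r, forall P Q,
  digits_near k P Q -> (len (digits_value P - digits_value Q)%R <= r)%N.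
Proof.
exists (\sum_(i < k) k * len (g i))%N => P Q [PQ1 PQ2].
have [N [PN [QN ->]]] := digits_valueB P Q.
rewrite -(@digit_sum_widen (maxn N k) N (fun i => P`_i - Q`_i)) ?leq_maxl //; last first.
  by move=> i Ni; rewrite !nth_default ?subrr // (leq_trans _ Ni).
rewrite (@digit_sum_widen (maxn N k) k (fun i => P`_i - Q`_i)) ?leq_maxr //; last first.
  by move=> i ki; rewrite PQ1 ?subrr.
apply: leq_trans (len_sum len_proper _ _) _.
apply: leq_sum => i _; apply: leq_trans (lenMz len_proper _ _) _.
by rewrite leq_mul2r PQ2 ?orbT.
Qed.

(** If m_N = 0, the coefficient of g_N is determined by the element, hence bounded on a ball;
    finiteness of balls enters as boundedness of every function to [nat]. If m_N > 0, the
    coefficient is below m_N. Removing the last term then enlarges the radius by a bounded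
    amount. *)
Let small_digits_bounded N r : exists K, forall c, small_digits c ->
  (len (\sum_(i < N) g i *~ c i)%R <= r -> forall i, i < N -> `|c i| <= K)%N.
Proof.
have [_ lenN lenD proper] := len_proper.
elim: N r => [|N IHN] r; first by exists 0%N.
pose s x := `|xget (0 : int) [set z | span g N (x - g N *~ z)]|%N.
have [K1 hK1] := proper s r.
pose K2 := maxn (m N) K1.
have [K3 hK3] := IHN (r + K2 * len (g N))%N.
exists (maxn K2 K3) => c smallc; rewrite big_ord_recr /= => cr.
have cN : (`|c N| <= K2)%N.
  rewrite leq_max; case: (smallc N) => [mN|/ltnW->//]; apply/orP; right.
  have := hK1 _ cr; rewrite /s; case: xgetP => [z _ /= xz|none _]; last first.
    by have := none (c N); rewrite /= addrK => /(_ (span_sum _ _ _)).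
  suff -> : c N = z by [].
  suff : (m N %| c N - z)%Z by rewrite mN dvd0z subr_eq0 => /eqP.
  apply/m_order; rewrite mulrzBr -(addKr (\sum_(i < N) g i *~ c i) (_ - _)) addrC addrA.
  by apply: spanB => //; exact: span_sum.
have le := lenMz len_proper (g N) (c N).
have /hK3/(_ _) : (len (\sum_(i < N) g i *~ c i)%R <= r + K2 * len (g N))%N.
  rewrite -[X in len X](addrK (g N *~ c N)) (leq_trans (lenD _ _)) // lenN.
  by apply: leq_add => //; apply: leq_trans le _; rewrite leq_mul2r cN orbT.
move=> /(_ smallc) cK i; rewrite ltnS leq_eqVlt leq_max => /predU1P[->|/cK->].
  by rewrite cN.
by rewrite orbT.
Qed.

(** A ball, being finite, lies in a single [span g j]. So the digits agree from rank j on, and below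
    j they differ by a bounded amount. *)
Lemma digits_value_proper r : exists k, forall P Q, reduced P -> reduced Q ->
  (len (digits_value P - digits_value Q)%R <= r)%N -> digits_near k P Q.
Proof.
have [_ _ _ proper] := len_proper.
have [s sP] := choice span_full.
have [j hj] := proper s r.
have [K hK] := small_digits_bounded j r.
exists (maxn j K) => P Q redP redQ PQr.
have small := reducedB redP redQ.
have [N [PN [QN e]]] := digits_valueB P Q.
have tail i : (j <= i)%N -> P`_i = Q`_i.
  move=> ji; have [Ni|iN] := leqP N i; first by rewrite !nth_default // (leq_trans _ Ni).
  apply/eqP; rewrite -subr_eq0; apply/eqP.
  apply: (small_digits_eq0 small (j := j) (N := N)); last by rewrite ji.
  by rewrite -e; apply: span_le (sP _); exact: hj.
split=> i; rewrite ?geq_max; first by case/andP => /tail.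
move=> _; have [/tail->|ij] := leqP j i; first by rewrite subrr.
rewrite leq_max (hK _ small) ?orbT //; rewrite e in PQr.
move: PQr; rewrite -(@digit_sum_widen (maxn N j) N (fun i => P`_i - Q`_i)) ?leq_maxl //; last first.
  by move=> l Nl; rewrite !nth_default ?subrr // (leq_trans _ Nl).
rewrite (@digit_sum_widen (maxn N j) j (fun i => P`_i - Q`_i)) ?leq_maxr // => l jl.
by rewrite tail ?subrr.
Qed.

End Digits.

(** * Coarse models *)

(* E k is the k-th entourage of a countably generated coarse structure. *)
Definition gauge X (E : nat -> X -> X -> Prop) :=
  (forall k x y, E k x y -> E k y x) /\
  (forall k l, exists m, forall x y z, E k x y -> E l y z -> E m x z).

Definition coarse_equiv X Y (E : nat -> X -> X -> Prop)
    (F : nat -> Y -> Y -> Prop) (f : X -> Y) :=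
  [/\ forall k, exists l, forall x y, E k x y -> F l (f x) (f y),
      forall l, exists k, forall x y, F l (f x) (f y) -> E k x y
    & exists l, forall y, exists x, F l (f x) y].

Lemma coarse_equiv_inv X Y (E : nat -> X -> X -> Prop) F (f : X -> Y) :
  gauge F -> coarse_equiv E F f ->
  exists h, [/\ coarse_equiv F E h, exists k, forall x, E k (h (f x)) x
    & exists l, forall y, F l (f (h y)) y].
Proof.
move=> [Fsym Ftrans] [EF FE [l0 /choice[h hP]]]; exists h.
have hf : exists k, forall x, E k (h (f x)) x.
  by have [k kP] := FE l0; exists k => x; exact: kP.
split=> //; last by exists l0.
split=> [k|l|].
- have [m1 m1P] := Ftrans l0 k; have [m2 m2P] := Ftrans m1 l0.
  have [l lP] := FE m2; exists l => x y xy; apply: lP.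
  by apply: m2P (Fsym _ _ _ (hP y)); exact: m1P (hP x) xy.
- have [k kP] := EF l; have [m1 m1P] := Ftrans l0 k; have [m2 m2P] := Ftrans m1 l0.
  exists m2 => x y /kP xy; apply: m2P (hP y); apply: m1P xy.
  exact/Fsym.
- by have [k kP] := hf; exists k => x; exists (f x); exact: kP.
Qed.

Lemma coarse_equiv_comp X Y Z (E : nat -> X -> X -> Prop) F
    (G : nat -> Z -> Z -> Prop) (f : X -> Y) (h : Y -> Z) :
  gauge G -> coarse_equiv E F f -> coarse_equiv F G h ->
  coarse_equiv E G (h \o f).
Proof.
move=> [Gsym Gtrans] [EF FE [a fa]] [FG GF [b hb]]; split=> [k|l|].
- have [l lP] := EF k; have [m mP] := FG l.
  by exists m => x y /lP/mP.
- have [k kP] := GF l; have [m mP] := FE k.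
  by exists m => x y /kP/mP.
- have [c cP] := FG a; have [m mP] := Gtrans c b; exists m => z.
  have [y yz] := hb z; have [x xy] := fa y; exists x.
  by apply: mP yz; exact: cP.
Qed.

Definition len_near (G : zmodType) (len : G -> nat) k (x y : G) : Prop :=
  (len (x - y)%R <= k)%N.

Lemma len_near_gauge (G : zmodType) (len : G -> nat) :
  proper_length len -> gauge (len_near len).
Proof.
case=> _ lenN lenD _; split=> [k x y|k l]; first by rewrite /len_near -lenN opprB.
exists (k + l)%N => x y z xy yz; rewrite /len_near -(subrK y x) -addrA.
by apply: leq_trans (lenD _ _) _; exact: leq_add.
Qed.

Definition vec_near n k (v w : 'rV[int]_n) := forall i, (`|(v 0 i - w 0 i)%R| <= k)%N.

Lemma digits_near_coef k (P Q : {poly int}) i :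
  digits_near k P Q -> `|P`_i - Q`_i| <= k%:Z.
Proof.
by move=> [h1 h2]; rewrite -abszE; have [/h2//|/h1->] := ltnP i k; rewrite subrr.
Qed.

Lemma digits_near_gauge : gauge digits_near.
Proof.
split=> [k P Q [h1 h2]|k l].
  by split=> i ik; [rewrite h1|rewrite -abszN opprB h2].
exists (k + l)%N => P Q R PQ QR; split=> i.
  by move=> ik; rewrite PQ.1 ?QR.1 //; lia.
have := digits_near_coef i PQ; have := digits_near_coef i QR.
by move: P`_i Q`_i R`_i => a b c; lia.
Qed.

Lemma quotient_bound (p q r t M : int) (l : nat) :
    0 <= q < M -> 0 <= t < M ->
  (`|(p * M + q - (r * M + t))%R| <= l)%N -> `|p - r| <= l.+1%:Z.
Proof.
move=> q0 t0 le.
have M0 : 0 < M by lia.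
have lM : l%:Z <= l%:Z * M by rewrite ler_peMr //; lia.
have [h1 h2] : (p - r) * M <= l.+1%:Z * M /\ - l.+1%:Z * M <= (p - r) * M.
  move: le lM; rewrite mulNr mulrBl -addn1 PoszD mulrDl mul1r.
  by move: (p * M) (r * M) (l%:Z * M) => a b c; lia.
by rewrite ler_norml -(ler_pM2r M0) h2 -(ler_pM2r M0) h1.
Qed.

(** * Groups of infinite rank *)

Section InfiniteRank.
Variables (G : zmodType) (g : nat -> G) (m : nat -> nat) (len : G -> nat).
Hypothesis span_full : forall x, exists k, span g k x.
Hypothesis m_order : forall k z, span g k (g k *~ z) <-> (m k %| z)%Z.
Hypothesis len_proper : proper_length len.
Hypothesis m_even : forall k, m k.*2 = 0%N.
Hypothesis m_odd : forall k, (0 < m k.*2.+1)%N.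

(** Division by m identifies Z with Z x {0, ..., m - 1}: each copy of Z absorbs the finite factor
    that follows it. *)
Let merge (P : {poly int}) : {poly int} :=
  \poly_(k < size P) (P`_k.*2 * (m k.*2.+1)%:Z + P`_k.*2.+1).

Let mergeE P k : (merge P)`_k = P`_k.*2 * (m k.*2.+1)%:Z + P`_k.*2.+1.
Proof.
rewrite coef_poly; case: ltnP => // Pk.
have P2 : (size P <= k.*2)%N by rewrite -addnn (leq_trans Pk) ?leq_addr.
by rewrite nth_default // mul0r nth_default ?addr0 // leqW.
Qed.

Let reduced_odd P k : reduced m P -> 0 <= P`_k.*2.+1 < (m k.*2.+1)%:Z.
Proof.
move=> redP; rewrite -redP; have := m_odd k => m0.
by rewrite modz_ge0 ?ltz_pmod //; lia.
Qed.

Let mergeK k P Q : reduced m P -> reduced m Q ->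
  (merge P)`_k = (merge Q)`_k -> P`_k.*2 = Q`_k.*2 /\ P`_k.*2.+1 = Q`_k.*2.+1.
Proof.
move=> /(reduced_odd k) hP /(reduced_odd k) hQ; rewrite !mergeE; have := m_odd k.
move=> m0 e; have m0' : (m k.*2.+1)%:Z != 0 by lia.
have ac : P`_k.*2 = Q`_k.*2.
  have := congr1 (fun z => (z %/ (m k.*2.+1)%:Z)%Z) e.
  by rewrite /= !divzMDl // !divz_small ?addr0 //; lia.
by split=> //; move: e; rewrite ac => /addrI.
Qed.

Let double_cases i : exists h, i = h.*2 \/ i = h.*2.+1.
Proof.
exists i./2; have := odd_double_half i; case: (odd i) => /= e; [right|left];
  by rewrite -[LHS]e.
Qed.

(** The model, all of [{poly int}] with [digits_near], is the restricted product of countably many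
    copies of Z and does not depend on G. *)
Lemma infinite_rank_model : exists f, coarse_equiv (len_near len) digits_near f.
Proof.
have /choice[s sP] x : exists P, reduced m P /\ digits_value g P = x.
  by have [P ? ?] := reduced_exists span_full m_order x; exists P.
exists (merge \o s); split=> [k|l|].
- have [k1 k1P] := digits_value_proper span_full m_order len_proper k.
  (* In [digits_near] one number is both rank and bound. This one is at least k1, and it bounds the
     effect on the merged digit of changing quotient and remainder by k1. *)
  exists (k1 * (\sum_(i < k1) m i.*2.+1)%N + k1)%N => x y xy.
  have near : digits_near k1 (s x) (s y).
    apply: k1P; [exact: (sP x).1|exact: (sP y).1|].
    by rewrite (sP x).2 (sP y).2.
  have h1 := near.1; split=> i; rewrite /= !mergeE.
    move=> ik; have [i1 i2] : (k1 <= i.*2 /\ k1 <= i.*2.+1)%N.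
      by rewrite -addnn; split; lia.
    by rewrite !h1.
  move=> _; have [ki|ik] := leqP k1 i.
    by rewrite !h1 ?subrr // -addnn; lia.
  have := digits_near_coef i.*2 near; have := digits_near_coef i.*2.+1 near.
  have c : (m i.*2.+1 <= \sum_(i < k1) m i.*2.+1)%N.
    by rewrite (bigD1 (Ordinal ik)) //= leq_addr.
  move: (_`__) (_`__) (_`__) (_`__) (m _) (\sum_(_ < _) _)%N c => p q r t M S.
  nia.
- pose M := (\sum_(i < l) m i.*2.+1)%N.
  (* Merged digits of rank below l come from digits of rank below 2 l; their quotients change by at
     most l + 1 and their remainders by at most M. *)
  have [k kP] := digits_value_bornologous g len_proper (2 * l + l.+1 + M).
  exists k => x y [h1 h2]; rewrite /len_near -(sP x).2 -(sP y).2; apply: kP.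
  have redx := (sP x).1; have redy := (sP y).1.
  have tail h : (l <= h)%N ->
      (s x)`_h.*2 = (s y)`_h.*2 /\ (s x)`_h.*2.+1 = (s y)`_h.*2.+1.
    by move=> lh; apply: mergeK => //; exact: h1.
  have bound h : `|(s x)`_h.*2 - (s y)`_h.*2| <= (2 * l + l.+1 + M)%N%:Z /\
      `|(s x)`_h.*2.+1 - (s y)`_h.*2.+1| <= (2 * l + l.+1 + M)%N%:Z.
    have [lh|hl] := leqP l h; first by have [-> ->] := tail h lh; rewrite !subrr.
    have := h2 _ hl; rewrite /= !mergeE.
    have ox := reduced_odd h redx; have oy := reduced_odd h redy.
    move=> le; have := quotient_bound ox oy le; move: le ox oy.
    have : (m h.*2.+1 <= M)%N by rewrite /M (bigD1 (Ordinal hl)) //= leq_addr.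
    move: (_`__) (_`__) (_`__) (_`__) (m _) => p q r t M'; lia.
  split=> i.
    have [h [->|->]] := double_cases i => hl.
      by have [] := tail h => //; rewrite -leq_double -!addnn in hl *; lia.
    by have [] := tail h => //; rewrite -leq_double -!addnn in hl *; lia.
  by have [h [->|->]] := double_cases i => _; rewrite -lez_nat abszE; have [] := bound h.
- exists 0%N => R.
  pose P : {poly int} := \poly_(j < (size R).*2)
    (if odd j then R`_j./2 %% m j else R`_j./2 %/ m j.+1)%Z.
  have PE j : P`_j = (if odd j then R`_j./2 %% m j else R`_j./2 %/ m j.+1)%Z.
    rewrite coef_poly; case: ltnP => // Rj.
    by rewrite nth_default ?mod0z ?div0z ?if_same // geq_half_double.
  have redP : reduced m P.
    move=> j; rewrite PE; case: ifP => oj; first by rewrite modz_mod.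
    have -> : m j = 0%N by rewrite -[j]odd_double_half oj m_even.
    by rewrite modz0.
  exists (digits_value g P); rewrite /=.
  have -> : s (digits_value g P) = P.
    by apply: (digits_value_inj m_order (sP _).1 redP (sP _).2).
  have -> : merge P = R.
    apply/polyP => i; rewrite mergeE !PE /= odd_double uphalf_double doubleK.
    by rewrite -divz_eq.
  by split.
Qed.

End InfiniteRank.

Lemma small_multiple_eq0 (x y : int) : 0 < y -> `|x * y| < y -> x = 0.
Proof.
move=> y0; rewrite normrM (gtr0_norm y0) gtr_pMl //; lia.
Qed.

(** * Colouring the lattice Z^n *)

Section LatticeColoring.
Variables (n w : nat).
Let W : int := w.+1%:Z.
Let period : int := n.+1%:Z * W.

Let good (i : nat) (z : int) := ((z - i.+1%:Z * W) %% period)%Z < period - W.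

Let period_gt0 : 0 < period. Proof. by rewrite /period /W; lia. Qed.
Let period_ge i : (i <= n)%N -> i.+1%:Z * W <= period.
Proof. by move=> i_n; rewrite /period ler_wpM2r // /W; lia. Qed.

(* The windows [i W, (i + 1) W) modulo the period are disjoint. *)
Let good_except i j z : (i <= n)%N -> (j <= n)%N ->
  ~~ good i z -> ~~ good j z -> i = j.
Proof.
move=> i_n j_n; rewrite /good -!leNgt.
have ei := divz_eq (z - i.+1%:Z * W) period.
have ej := divz_eq (z - j.+1%:Z * W) period.
have := ltz_pmod (z - i.+1%:Z * W) period_gt0.
have := ltz_pmod (z - j.+1%:Z * W) period_gt0.
move: ei ej; set q := (_ %/ _)%Z; set r := (_ %% _)%Z.
set q' := (_ %/ _)%Z; set r' := (_ %% _)%Z => ei ej r1 r2 r3 r4.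
have W0 : 0 < W by [].
have hi := period_ge i_n; have hj := period_ge j_n.
have iW : 0 <= i%:Z * W by rewrite mulr_ge0.
have jW : 0 <= j%:Z * W by rewrite mulr_ge0.
have SW l : l.+1%:Z * W = l%:Z * W + W by rewrite -addn1 PoszD mulrDl mul1r.
rewrite (SW i) in hi ei; rewrite (SW j) in hj ej.
have qq : q - q' = 0.
  apply: (small_multiple_eq0 period_gt0); rewrite mulrBl.
  by move: (q * _) (q' * _) (i%:Z * W) (j%:Z * W) ei ej hi hj iW jW => a b c d; lia.
have : i%:Z - j%:Z = 0; last by lia.
apply: (small_multiple_eq0 W0); rewrite mulrBl.
have : q * period = q' * period by congr (_ * _); lia.
by move: (q * _) (q' * _) (i%:Z * W) (j%:Z * W) ei ej hi hj iW jW => a b c d; lia.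
Qed.

(** Each of the n coordinates excludes at most one of the n + 1 colours. *)
Let good_exists (v : 'rV[int]_n) : exists i : 'I_n.+1, forall k, good i (v 0 k).
Proof.
have [//|none] := pselect (exists i : 'I_n.+1, forall k, good i (v 0 k)).
have /choice[f fP] (i : 'I_n.+1) : exists k : 'I_n, ~~ good i (v 0 k).
  apply/existsP; apply: contraT; rewrite negb_exists => /forallP h.
  by case: none; exists i => k; have := h k; rewrite negbK.
have inj : injective f.
  move=> i j ij; apply/val_inj/(@good_except _ _ (v 0 (f i))).
  - exact: leq_ord.
  - exact: leq_ord.
  - exact: fP.
  - by rewrite ij; exact: fP.
by have := leq_card f inj; rewrite !card_ord ltnn.
Qed.

(** Removing the windows of one colour in every coordinate cuts Z^n into boxes of side period - W,
    separated by gaps of width W = w + 1; q is the index of the box. *)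
Lemma lattice_coloring :
  exists (c : 'rV[int]_n -> 'I_n.+1) (q : 'rV[int]_n -> 'rV[int]_n) (B : nat),
    (forall u v, c u = c v -> vec_near w u v -> q u = q v) /\
    (forall u v, c u = c v -> q u = q v -> vec_near B u v).
Proof.
have /choice[c cP] := good_exists.
exists c, (fun v : 'rV[int]_n => \row_k divz (v 0 k - (c v).+1%:Z * W) period), `|period|%N.
split=> u v cuv uv.
  apply/rowP => k; rewrite !mxE.
  have := cP u k; have := cP v k; rewrite /good cuv; move: (uv k).
  have eu := divz_eq (u 0 k - (c v).+1%:Z * W) period.
  have ev := divz_eq (v 0 k - (c v).+1%:Z * W) period.
  have := modz_ge0 (u 0 k - (c v).+1%:Z * W) (lt0r_neq0 period_gt0).
  have := modz_ge0 (v 0 k - (c v).+1%:Z * W) (lt0r_neq0 period_gt0).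
  move: eu ev; set q := (_ %/ _)%Z; set r := (_ %% _)%Z.
  set q' := (_ %/ _)%Z; set r' := (_ %% _)%Z => eu ev r1 r2 near r3 r4.
  suff : q - q' = 0 by lia.
  apply: (small_multiple_eq0 period_gt0); rewrite mulrBl.
  move: near r3 r4; rewrite /W; move: period (q * _) (q' * _) (_ * _) eu ev.
  by move=> P a b d; lia.
move=> k; move/rowP/(_ k): uv; rewrite !mxE cuv.
have eu := divz_eq (u 0 k - (c v).+1%:Z * W) period.
have ev := divz_eq (v 0 k - (c v).+1%:Z * W) period.
have := modz_ge0 (u 0 k - (c v).+1%:Z * W) (lt0r_neq0 period_gt0).
have := modz_ge0 (v 0 k - (c v).+1%:Z * W) (lt0r_neq0 period_gt0).
have := ltz_pmod (u 0 k - (c v).+1%:Z * W) period_gt0.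
have := ltz_pmod (v 0 k - (c v).+1%:Z * W) period_gt0.
move: eu ev; set q := (_ %/ _)%Z; set r := (_ %% _)%Z.
set q' := (_ %/ _)%Z; set r' := (_ %% _)%Z => eu ev r1 r2 r3 r4 qq.
rewrite qq in eu; move: period_gt0 eu ev r1 r2 r3 r4.
by move: period (q' * _) (_ * W) => P a b; lia.
Qed.

End LatticeColoring.

(** * Groups of finite rank *)

Section FiniteRank.
Variables (G : zmodType) (g : nat -> G) (m : nat -> nat) (len : G -> nat) (n : nat).
Hypothesis span_full : forall x, exists k, span g k x.
Hypothesis m_order : forall k z, span g k (g k *~ z) <-> (m k %| z)%Z.
Hypothesis len_proper : proper_length len.
Hypothesis m_free : forall i, (i < n)%N -> m i = 0%N.
Hypothesis m_torsion : forall i, (n <= i)%N -> (0 < m i)%N.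

Let m_le_sum i K : (i < K)%N -> (m i <= \sum_(j < K) m j)%N.
Proof. by move=> iK; rewrite (bigD1 (Ordinal iK)) //= leq_addr. Qed.

Let reduced_bound P i : reduced m P -> (n <= i)%N -> 0 <= P`_i < (m i)%:Z.
Proof.
move=> redP ni; rewrite -redP; have := m_torsion ni => m0.
by rewrite modz_ge0 ?ltz_pmod //; lia.
Qed.

Let reduced_dist P Q i : reduced m P -> reduced m Q -> (n <= i)%N ->
  (`|(P`_i - Q`_i)%R| <= m i)%N.
Proof.
move=> redP redQ ni; have := reduced_bound redP ni; have := reduced_bound redQ ni.
by move: P`_i Q`_i (m i) => a b c; lia.
Qed.

Definition free_part (P : {poly int}) : 'rV[int]_n := \row_i P`_i.

Let near_of_free_part P Q k K : reduced m P -> reduced m Q ->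
    vec_near k (free_part P) (free_part Q) ->
    (forall i, (K <= i)%N -> (n <= i)%N -> P`_i = Q`_i) ->
  digits_near (k + K + n + \sum_(j < K) m j) P Q.
Proof.
move=> redP redQ PQ tail; split=> i iK; first by
    apply: tail; move: (\sum_(_ < _) _)%N iK => S; lia.
have [ni|i_n] := leqP n i; last first.
  have := PQ (Ordinal i_n); rewrite !mxE /=.
  by move: (\sum_(_ < _) _)%N P`_i Q`_i => S a b; lia.
have [Ki|{}iK] := leqP K i; first by rewrite tail ?subrr.
have := reduced_dist redP redQ ni; have := m_le_sum iK.
by move: (\sum_(_ < _) _)%N P`_i Q`_i => S a b; lia.
Qed.

Let digits : exists s : G -> {poly int},
  forall x, reduced m (s x) /\ digits_value g (s x) = x.
Proof.
have /choice[s sP] x : exists P, reduced m P /\ digits_value g P = x.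
  by have [P ? ?] := reduced_exists span_full m_order x; exists P.
by exists s.
Qed.

(** Only the free digits need colours. Nearness at scale D forces the digits from rank k on to
    agree, so the finite ones among them can be put into the class; below rank k the finite digits
    vary boundedly anyway. *)
Lemma finite_rank_coloring D :
  exists (W : Type) (c : G -> 'I_n.+1) (r : G -> W) (B : nat),
    (forall x y, c x = c y -> len_near len D x y -> r x = r y) /\
    (forall x y, c x = c y -> r x = r y -> len_near len B x y).
Proof.
have [s sP] := digits.
have [k kP] := digits_value_proper span_full m_order len_proper D.
have [c [q [B [cq qB]]]] := lattice_coloring n k.
have [B' B'P] :=
  digits_value_bornologous g len_proper (B + k + n + \sum_(j < k) m j)%N.
exists ('rV[int]_n * (nat -> int))%type, (fun x => c (free_part (s x))).
exists (fun x => (q (free_part (s x)),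
  fun i => if (k <= i)%N && (n <= i)%N then (s x)`_i else 0)), B'.
split=> x y cxy.
  move=> xy; have near : digits_near k (s x) (s y).
    apply: kP; [exact: (sP x).1|exact: (sP y).1|].
    by rewrite (sP x).2 (sP y).2.
  congr (_, _).
    apply: cq => // i; rewrite !mxE.
    by have := digits_near_coef i near; rewrite -abszE lez_nat.
  by apply/funext => i; case: ifP => // /andP[ki _]; rewrite near.1.
case=> /(qB _ _ cxy) xy tail; rewrite /len_near -(sP x).2 -(sP y).2.
apply: B'P; apply: near_of_free_part xy _; [exact: (sP x).1|exact: (sP y).1|].
by move=> i ki ni; have := congr1 (fun f => f i) tail; rewrite /= ki ni.
Qed.

Lemma finite_rank_fg_model J : (forall x, span g J x) ->
  exists f, coarse_equiv (len_near len) (@vec_near n) f.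
Proof.
move=> fullJ; have [s sP] := digits.
have sJ x i : (J <= i)%N -> (s x)`_i = 0.
  move=> Ji; have [P redP [PJ xP]] := reduced_span m_order (fullJ x).
  have -> : s x = P.
    apply: (digits_value_inj m_order (sP x).1 redP).
    by rewrite (sP x).2 xP; apply/esym/digits_valueE.
  by rewrite nth_default // (leq_trans PJ).
exists (free_part \o s); split=> [k|l|].
- have [k1 k1P] := digits_value_proper span_full m_order len_proper k.
  exists k1 => x y xy i; rewrite !mxE.
  have near : digits_near k1 (s x) (s y).
    apply: k1P; [exact: (sP x).1|exact: (sP y).1|].
    by rewrite (sP x).2 (sP y).2.
  by have := digits_near_coef i near; rewrite -abszE lez_nat.
- have [B BP] :=
    digits_value_bornologous g len_proper (l + J + n + \sum_(j < J) m j)%N.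
  exists B => x y xy; rewrite /len_near -(sP x).2 -(sP y).2; apply: BP.
  apply: near_of_free_part xy _; [exact: (sP x).1|exact: (sP y).1|].
  by move=> i Ji _; rewrite !sJ.
- exists 0%N => v.
  pose P : {poly int} := \poly_(i < n) (if insub i is Some i' then v 0 i' else 0).
  have redP : reduced m P.
    move=> i; rewrite coef_poly; case: ltnP => [i_n|_]; last by rewrite mod0z.
    by rewrite m_free // modz0.
  exists (digits_value g P) => i /=.
  have -> : s (digits_value g P) = P.
    exact: (digits_value_inj m_order (sP _).1 redP (sP _).2).
  by rewrite !mxE coef_poly ltn_ord valK subrr.
Qed.

Definition place k := (\prod_(i < k) m (n + i))%N.

(** Equal quotients by [place k] mean equal digits from rank k on. The lower digits take finitely
    many values, so they need no bound. *)
Definition mixed_near k (a b : 'rV[int]_n * nat) :=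
  vec_near k a.1 b.1 /\ (a.2 %/ place k = b.2 %/ place k)%N.

Hypothesis place_unbounded : forall B, exists k, (B <= place k)%N.

Let placeS k : place k.+1 = (place k * m (n + k))%N.
Proof. by rewrite /place big_ord_recr. Qed.

Let place_gt0 k : (0 < place k)%N.
Proof. by apply: prodn_cond_gt0 => i _; rewrite m_torsion ?leq_addr. Qed.

Let place_dvd k l : (k <= l)%N -> (place k %| place l)%N.
Proof.
by move/subnK <-; elim: (l - k)%N => // d IHd; rewrite addSn placeS dvdn_mulr.
Qed.

Lemma place_place_values : place_values place.
Proof.
split=> // [|j]; first by rewrite /place big_ord0.
by apply: place_dvd.
Qed.

Let digit i x := (x %/ place i %% m (n + i))%N.

Let digit_large i k x : (x < place k)%N -> (k <= i)%N -> digit i x = 0%N.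
Proof.
move=> xk ki; rewrite /digit divn_small ?mod0n //.
by apply: leq_trans xk _; apply: dvdn_leq => //; exact: place_dvd.
Qed.

Let divn_place k i x y : (k <= i)%N ->
  (x %/ place k = y %/ place k -> x %/ place i = y %/ place i)%N.
Proof.
by move=> /place_dvd/dvdnP[q ->]; rewrite mulnC !divnMA => ->.
Qed.

(** Downward induction from a rank so high that both quotients are 0. *)
Let digits_divn k x y : (forall i, (k <= i)%N -> digit i x = digit i y) ->
  (x %/ place k = y %/ place k)%N.
Proof.
move=> xy; have [J hJ] := place_unbounded (x + y).+1.
suff h d : (x %/ place (k + (J - d)) = y %/ place (k + (J - d)))%N.
  by have := h J; rewrite subnn addn0.
elim: d => [|d IHd].
  have hk : (place J <= place (k + J))%N.
    by apply: dvdn_leq => //; apply: place_dvd; exact: leq_addl.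
  by rewrite subn0 !divn_small //; lia.
have [Jd|dJ] := leqP J d.
  by move: IHd; have -> : (J - d.+1 = J - d)%N by lia.
move: IHd; have -> : (J - d = (J - d.+1).+1)%N by lia.
rewrite addnS; set i := (k + _)%N; rewrite placeS !divnMA => e.
rewrite (divn_eq (x %/ place i) (m (n + i))) (divn_eq (y %/ place i) (m (n + i))).
by rewrite e -!/(digit i _) xy // leq_addr.
Qed.

Let digits_surj J (d : nat -> nat) : (forall i, (d i < m (n + i))%N) ->
  exists2 x, (x < place J)%N & forall i, (i < J)%N -> digit i x = d i.
Proof.
move=> dm; elim: J => [|J [x xJ xd]]; first by exists 0%N.
have mJ : (0 < m (n + J))%N by rewrite m_torsion ?leq_addr.
exists (x + d J * place J)%N.
  rewrite placeS; have : (d J * place J + place J <= m (n + J) * place J)%N.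
    by rewrite -mulSnr leq_mul2r dm orbT.
  by rewrite mulnC [X in (_ < X)%N]mulnC [X in (_ < X)%N]mulnC; lia.
move=> i; rewrite ltnS leq_eqVlt => /predU1P[->|iJ].
  by rewrite /digit divnDMl // divn_small // add0n modn_small.
have /dvdnP[q qJ] : (place i.+1 %| place J)%N by exact: place_dvd.
rewrite -(xd i iJ) /digit qJ placeS !mulnA mulnAC divnDMl //.
by rewrite addnC modnMDl.
Qed.

(** The map is built from the model to G, because the digits of a natural number are given by a
    formula; its coarse inverse is the one required. *)
Lemma finite_rank_model : exists f, coarse_equiv (len_near len) mixed_near f.
Proof.
have [J JP] := choice place_unbounded.
pose coef (a : 'rV[int]_n * nat) i : int :=
  if insub i is Some i' then a.1 0 i' else (digit (i - n) a.2)%:Z.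
(* [place (J b.+1)] exceeds b, so the digits of b vanish from rank [J b.+1] on. *)
pose P a : {poly int} := \poly_(i < n + J a.2.+1) coef a i.
have P_free a : free_part (P a) = a.1.
  apply/rowP => i; rewrite mxE coef_poly ifT /coef ?valK //.
  by rewrite ltn_addr.
have P_torsion a i : (P a)`_(n + i) = (digit i a.2)%:Z.
  rewrite coef_poly ltn_add2l /coef insubN -?leqNgt ?leq_addr // addKn.
  by case: ltnP => // Ji; rewrite (@digit_large _ (J a.2.+1)).
have redP a : reduced m (P a).
  move=> i; have [ni|i_n] := leqP n i; last by rewrite m_free // modz0.
  rewrite -(subnKC ni) P_torsion modz_small //= ltz_nat.
  by rewrite ltn_mod m_torsion // leq_addr.
have f_near : coarse_equiv mixed_near (len_near len) (digits_value g \o P).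
  split=> [k|l|].
  - have [B BP] := digits_value_bornologous g len_proper
      (k + (n + k) + n + \sum_(j < n + k) m j)%N.
    exists B => a b [ab1 ab2]; apply: BP; apply: near_of_free_part => //.
      by rewrite !P_free.
    move=> i nki ni; rewrite -(subnKC ni) !P_torsion; congr (_%:Z).
    by rewrite /digit (divn_place _ ab2) //; lia.
  - have [k kP] := digits_value_proper span_full m_order len_proper l.
    exists k => a b /(kP _ _ (redP a) (redP b)) near; split.
      rewrite -!P_free => i; rewrite !mxE.
      by have := digits_near_coef i near; rewrite -abszE lez_nat.
    apply: digits_divn => i ki; have kni : (k <= n + i)%N by lia.
    by have := near.1 _ kni; rewrite !P_torsion => -[].
  - exists 0%N => x; have [Q redQ <-] := reduced_exists span_full m_order x.
    have [d dP] : exists d : nat -> nat, forall i,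
        (d i < m (n + i))%N /\ (d i)%:Z = Q`_(n + i).
      exists (fun i => absz Q`_(n + i)) => i.
      have := reduced_bound redQ (leq_addr i n).
      by move: Q`_(n + i) (m _) => z M; lia.
    have [y yJ yd] := @digits_surj (size Q) d (fun i => (dP i).1).
    exists (free_part Q, y); rewrite /=.
    suff -> : P (free_part Q, y) = Q.
      by rewrite /len_near subrr; case: len_proper => ->.
    apply/polyP => i; have [ni|i_n] := leqP n i; last first.
      have := congr1 (fun v : 'rV_n => v 0 (Ordinal i_n)) (P_free (free_part Q, y)).
      by rewrite /= !mxE.
    rewrite -(subnKC ni) P_torsion /=.
    have [Qi|iQ] := leqP (size Q) (i - n); last by rewrite yd // (dP _).2.
    rewrite (digit_large yJ) // nth_default //; apply: leq_trans Qi _.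
    by rewrite leq_addl.
have [h [hP _ _]] := coarse_equiv_inv (len_near_gauge len_proper) f_near.
by exists h.
Qed.

End FiniteRank.

Local Open Scope classical_set_scope.
Local Open Scope ring_scope.

(** * Torsion-free rank and generating sequences *)

Section LinearCombinations.
Variables (G : zmodType) (n : nat) (e : 'I_n -> G).

Definition lin_comb (v : 'rV[int]_n) : G := \sum_i e i *~ v 0 i.

Lemma lin_comb_is_zmod_morphism : zmod_morphism lin_comb.
Proof.
move=> u v; rewrite /lin_comb -sumrB; apply: eq_bigr => i _.
by rewrite !mxE mulrzBr.
Qed.

HB.instance Definition _ :=
  GRing.isZmodMorphism.Build 'rV[int]_n G lin_comb lin_comb_is_zmod_morphism.

Definition independent := forall v : 'rV[int]_n, lin_comb v = 0 -> v = 0.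

End LinearCombinations.

Lemma additive_lin_comb (G : zmodType) n (f : {additive 'rV[int]_n -> G}) v :
  f v = lin_comb (fun i => f (delta_mx 0 i)) v.
Proof.
rewrite {1}(row_sum_delta v) raddf_sum; apply: eq_bigr => i _.
by rewrite -{1}[v 0 i]intz scaler_int raddfMz.
Qed.

Lemma embeds_ZnP (G : zmodType) n :
  embeds_Zn G n <-> exists e : 'I_n -> G, independent e.
Proof.
split=> [[A [f [_ [_ finj _]]]]|[e ind]].
  exists (fun i => f (delta_mx 0 i)) => v; rewrite -additive_lin_comb -(raddf0 f).
  by move=> fv; apply: finj => //; rewrite in_setE.
exists (range (lin_comb e)), (lin_comb e); split.
  split=> [|x y]; rewrite !inE; first by exists 0; rewrite ?raddf0.
  by move=> [u _ <-] [v _ <-]; exists (u - v); rewrite ?raddfB.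
split=> [v _|u v _ _ uv|x [v _ <-]]; [by exists v| |by exists v].
by apply/eqP; rewrite -subr_eq0; apply/eqP/ind; rewrite raddfB /= uv subrr.
Qed.

Lemma lin_comb_span (G : zmodType) (g : nat -> G) n v :
  span g n (lin_comb (fun i : 'I_n => g i) v).
Proof.
have := span_sum g n (fun i => if insub i is Some i' then v 0 i' else 0).
by under eq_bigr do rewrite valK.
Qed.

Lemma span_ext (G : zmodType) (g h : nat -> G) k x :
  (forall i, (i < k)%N -> g i = h i) -> span g k x -> span h k x.
Proof.
elim: k x => // k IHk x gh [z xz]; exists z; apply: IHk => [i ik|].
  by apply: gh; exact: leqW.
by rewrite -gh.
Qed.

Section FiniteRankSequence.
Variables (G : zmodType) (n : nat) (enum : nat -> G).
Hypothesis enum_surj : forall x, exists k, enum k = x.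
Hypothesis embeds_n : embeds_Zn G n.
Hypothesis embeds_max : forall k, embeds_Zn G k -> (k <= n)%N.

(** A maximal independent family comes first, then an enumeration of G. An enumerated element of
    infinite order modulo its predecessors would yield n + 1 independent elements. *)
Lemma finite_rank_sequence : exists (g : nat -> G) (m : nat -> nat),
  [/\ forall x, exists k, span g k x,
      forall k z, span g k (g k *~ z) <-> (m k %| z)%Z,
      forall i, (i < n)%N -> m i = 0%N
    & forall i, (n <= i)%N -> (0 < m i)%N].
Proof.
have /embeds_ZnP[e ind] := embeds_n.
pose g i := if insub i is Some i' then e i' else enum (i - n).
have ge (i : 'I_n) : g i = e i by rewrite /g valK.
have /choice[m mP] k : exists m : nat, forall z, span g k (g k *~ z) <-> (m %| z)%Z.
  apply: int_subgroup_generator => [|x y]; first by rewrite mulr0z; exact: span0.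
  by rewrite mulrzBr; exact: spanB.
exists g, m; split=> [x||i i_n|i ni]; last 2 first.
- have : span g i (g i *~ (m i)%:Z) by apply/mP.
  case/spanP => c cP.
  pose v : 'rV[int]_n := \row_j (if j == i :> nat then (m i)%:Z else
    if (j < i)%N then - c j else 0).
  have /ind/rowP/(_ (Ordinal i_n)) : lin_comb e v = 0.
    rewrite /lin_comb (bigD1 (Ordinal i_n)) //= mxE /= eqxx -ge /= cP.
    rewrite (big_ord_widen n (fun j => g j *~ c j) (ltnW i_n)) big_mkcond.
    rewrite [X in X + _](bigD1 (Ordinal i_n)) //= ltnn add0r -big_split big1 //=.
    move=> j; rewrite -val_eqE /= mxE => /negPf ->; rewrite -ge.
    by case: ltnP; rewrite ?mulr0z ?addr0 // mulrNz subrr.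
  by rewrite !mxE eqxx; lia.
- rewrite lt0n; apply/negP => /eqP mi0.
  pose e' (j : 'I_n.+1) := if insub (val j) is Some j' then e j' else g i.
  suff /embeds_max : embeds_Zn G n.+1 by rewrite ltnn.
  apply/embeds_ZnP; exists e' => v.
  rewrite /lin_comb big_ord_recr /= {2}/e' insubN ?ltnn // => v0.
  pose w : 'rV[int]_n := \row_j v 0 (widen_ord (leqnSn n) j).
  have wE : \sum_(j < n) e' (widen_ord (leqnSn n) j) *~ v 0 (widen_ord (leqnSn n) j)
      = lin_comb e w.
    by apply: eq_bigr => j _; rewrite mxE /e' /= valK.
  rewrite wE in v0.
  have vmax : v 0 ord_max = 0.
    move: v0; set c := v 0 ord_max => v0.
    suff : (m i %| c)%Z by rewrite mi0 dvd0z => /eqP.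
    apply/mP; rewrite -(addr0_eq v0); apply: spanN; apply: span_le ni _.
    have -> : lin_comb e w = lin_comb (fun j : 'I_n => g j) w.
      by apply: eq_bigr => j _; rewrite ge.
    exact: lin_comb_span.
  rewrite vmax mulr0z addr0 in v0.
  apply/rowP => j; rewrite mxE; have [j' ->|-> //] := unliftP ord_max j.
  have /rowP/(_ j') := ind _ v0; rewrite !mxE.
  by congr (v 0 _ = _); apply/val_inj; rewrite /= /bump leqNgt ltn_ord.
- have [k <-] := enum_surj x; exists (n + k).+1.
  have -> : enum k = g (n + k)%N by rewrite /g insubN ?addKn // -leqNgt leq_addr.
  exact: span_gen.
- exact: mP.
Qed.

End FiniteRankSequence.

Lemma countable_surj (G : zmodType) :
  countable [set: G] -> exists enum : nat -> G, forall x, exists k, enum k = x.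
Proof.
move=> /countable_injP[f finj].
exists (fun k => xget 0 [set x | f x = k]) => x; exists (f x).
case: xgetP => [y _ /= fy|/(_ x) []//].
by apply: (finj y x _ _ fy); rewrite in_setE.
Qed.

(* Otherwise multiples of the n independent elements are combinations of the k
   generators; the matrix of coefficients, padded with zero columns, is
   singular, which yields a linear relation. *)
Lemma span_free_element (G : zmodType) (g : nat -> G) k n :
  (k < n)%N -> embeds_Zn G n ->
  exists x, forall z, span g k (x *~ z) -> z = 0.
Proof.
move=> kn /embeds_ZnP[e ind].
have [//|none] := pselect (exists x, forall z, span g k (x *~ z) -> z = 0).
have /choice[t tP] (i : 'I_n) : exists t : int, t != 0 /\ span g k (e i *~ t).
  apply: contrapT => no; apply: none; exists (e i) => z zk.
  by apply: contrapT => /eqP z0; apply: no; exists z.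
pose T := \prod_i t i.
have T0 : T != 0 by apply/prodf_neq0 => i _; exact: (tP i).1.
have /choice[c cP] (i : 'I_n) :
    exists c : nat -> int, e i *~ T = \sum_(j < k) g j *~ c j.
  apply: spanP; rewrite /T (bigD1 i) //= mulrzA; apply: spanMz; exact: (tP i).2.
pose A : 'M[int]_n := \matrix_(i, j) if (j < k)%N then c i j else 0.
have : \det A == 0.
  rewrite (expand_det_col A (Ordinal kn)) big1 // => i _.
  by rewrite mxE /= ltnn mul0r.
case/det0P => v v0 vA; case/negP: v0; apply/eqP.
have vT : lin_comb e (v *~ T) = 0.
  rewrite raddfMz /lin_comb mulrz_suml.
  transitivity (\sum_(j < k) g j *~ \sum_i v 0 i * c i j).
    rewrite (eq_bigr (fun i => \sum_(j < k) g j *~ (v 0 i * c i j))); last first.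
      move=> i _; rewrite -mulrzA mulrC mulrzA cP mulrz_suml; apply: eq_bigr => j _.
      by rewrite -mulrzA mulrC.
    by rewrite exchange_big; apply: eq_bigr => j _; rewrite -mulrz_sumr.
  rewrite big1 // => j _.
  have jn : (j < n)%N by exact: ltn_trans kn.
  have /rowP/(_ (Ordinal jn)) := vA; rewrite !mxE.
  under eq_bigr do rewrite mxE /= ltn_ord.
  by move=> ->; rewrite mulr0z.
apply/rowP => i; have := ind _ vT; rewrite -scaler_int => /rowP/(_ i).
by rewrite !mxE intz => /eqP; rewrite mulf_eq0 (negPf T0) => /eqP.
Qed.

Section InfiniteRankSequence.
Variables (G : zmodType) (enum : nat -> G).
Hypothesis enum_surj : forall x, exists k, enum k = x.
Hypothesis embeds_unbounded : forall k, exists2 n, (k < n)%N & embeds_Zn G n.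

Let pick_exists (L : seq G) (x : G) : exists y,
  (forall z, span (nth 0 L) (size L) (y *~ z) -> z = 0) /\
  (y = x \/ exists2 z, z != 0 & span (nth 0 L) (size L) (x *~ z)).
Proof.
have [xfree|/existsNP[z]] :=
  pselect (forall z, span (nth 0 L) (size L) (x *~ z) -> z = 0).
  by exists x; split; [|left].
move/not_implyP => [xz z0].
have [n kn en] := embeds_unbounded (size L).
have [y yP] := span_free_element (nth 0 L) kn en.
by exists y; split=> //; right; exists z => //; exact/eqP.
Qed.

(** Position 2k receives an element of infinite order modulo the previous ones, position 2k + 1 the
    k-th element x of an enumeration. If x itself has infinite order, [pick] returns x, which then
    has order 1 at its second occurrence; otherwise a nonzero multiple of x is already in the span.
    So odd positions always have finite order. As [pick] depends on all earlier terms, [L k] carries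
    the first 2k of them. *)
Lemma infinite_rank_sequence : exists (g : nat -> G) (m : nat -> nat),
  [/\ forall x, exists k, span g k x,
      forall k z, span g k (g k *~ z) <-> (m k %| z)%Z,
      forall k, m k.*2 = 0%N
    & forall k, (0 < m k.*2.+1)%N].
Proof.
have /choice[pick pickP] (a : seq G * G) := pick_exists a.1 a.2.
pose L := fix L k := if k is k'.+1 then
  L k' ++ [:: pick (L k', enum k'); enum k'] else [::].
have sizeL k : size (L k) = k.*2.
  by elim: k => // k IHk; rewrite size_cat IHk addn2.
pose g i := nth 0 (L i.+1) i.
have gL k i : (i < k.*2)%N -> nth 0 (L k) i = g i.
  have step j : (i < j.*2)%N -> nth 0 (L j.+1) i = nth 0 (L j) i.
    by move=> ij; rewrite nth_cat sizeL ij.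
  have up d j : (i < j.*2)%N -> nth 0 (L (d + j)%N) i = nth 0 (L j) i.
    elim: d => // d IHd ij; rewrite addSn step ?IHd // doubleD.
    exact: leq_trans ij (leq_addl _ _).
  move=> ik; rewrite /g; have i2 : (i < i.+1.*2)%N by rewrite -addnn; lia.
  have [le|lt] := leqP k i.+1; first by rewrite -(subnK le) up.
  by rewrite -(subnK (ltnW lt)) up.
have g_even k : g k.*2 = pick (L k, enum k).
  by rewrite -(gL k.+1) ?doubleS // nth_cat sizeL ltnn subnn.
have g_odd k : g k.*2.+1 = enum k.
  by rewrite -(gL k.+1) ?doubleS // nth_cat sizeL ltnNge leqnSn /= subSnn.
have spanL k x : span (nth 0 (L k)) (size (L k)) x <-> span g k.*2 x.
  by rewrite sizeL; split; apply: span_ext => i ik; rewrite gL.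
have /choice[m mP] k : exists m : nat, forall z, span g k (g k *~ z) <-> (m %| z)%Z.
  apply: int_subgroup_generator => [|x y]; first by rewrite mulr0z; exact: span0.
  by rewrite mulrzBr; exact: spanB.
exists g, m; split=> // [x|k|k].
- by have [k <-] := enum_surj x; exists k.*2.+2; rewrite -g_odd; exact: span_gen.
- have [free _] := pickP (L k, enum k).
  have : (m k.*2 %| (m k.*2)%:Z)%Z by [].
  by move/mP; rewrite g_even => /spanL/free => -[].
- rewrite lt0n; apply/negP => /eqP m0.
  have [_ /= [e|[z z0 zk]]] := pickP (L k, enum k).
    have : span g k.*2.+1 (g k.*2.+1 *~ 1).
      by rewrite mulr1z g_odd -e -g_even; exact: span_gen.
    by move/mP; rewrite m0.
  have : span g k.*2.+1 (g k.*2.+1 *~ z) by rewrite g_odd; apply/spanS/spanL.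
  by move/mP; rewrite m0 dvd0z (negPf z0).
Qed.

End InfiniteRankSequence.

Lemma finite_set_bound (T : choiceType) (A : set T) (s : T -> nat) :
  finite_set A -> exists B, forall x, A x -> (s x <= B)%N.
Proof.
move=> /finite_seqP[X ->]; exists (\max_(x <- X) s x)%N => x /= xX.
exact: (@leq_bigmax_seq _ X predT s x).
Qed.

Lemma span_subgroup (G : zmodType) (g : nat -> G) k : is_subgroup [set x | span g k x].
Proof.
split=> [|x y]; rewrite !inE /=; first exact: span0.
exact: spanB.
Qed.

Lemma finitely_generatedP (G : zmodType) (g : nat -> G) :
  (forall x, exists k, span g k x) ->
  finitely_generated G <-> exists k, forall x, span g k x.
Proof.
move=> full; split=> [[A Afin AG]|[k kG]].
  have /choice[s sP] := full.
  have [s_bound sA] := finite_set_bound s Afin.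
  exists s_bound => x; have : [set: G] x by [].
  rewrite -AG => /(_ [set x | span g s_bound x]); apply; split.
    exact: span_subgroup.
  by move=> y /sA ys /=; apply: span_le (sP y).
exists (g @` `I_k); first exact/finite_image/finite_II.
apply/seteqP; split=> // x _ B [[B0 BB] gB].
have BS (c : nat -> int) j : (j <= k)%N -> B (\sum_(i < j) g i *~ c i).
  rewrite inE in B0.
  have B_sub a b : B a -> B b -> B (a - b).
    by move=> Ba Bb; have := BB a b; rewrite !inE; apply.
  have B_opp a : B a -> B (- a) by move=> Ba; rewrite -sub0r; exact: B_sub.
  have B_add a b : B a -> B b -> B (a + b).
    by move=> Ba /B_opp Bb; rewrite -[b]opprK; exact: B_sub.
  have B_muln a l : B a -> B (a *+ l).
    by move=> Ba; elim: l => [//|l IHl]; rewrite mulrS; exact: B_add.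
  elim: j => [|j IHj] jk; first by rewrite big_ord0.
  rewrite big_ord_recr; apply: B_add; first exact/IHj/ltnW.
  have Bg : B (g j) by apply: gB; exists j.
  case: (c j) => l /=; rewrite ?NegzE ?mulrNz -?pmulrn; last apply: B_opp;
  exact: B_muln.
by have [c ->] := spanP (kG x); exact: BS.
Qed.

Lemma embeds_Zn_cases (G : zmodType) :
  (exists n, embeds_Zn G n /\ forall k, embeds_Zn G k -> (k <= n)%N) \/
  (forall k, exists2 n, (k < n)%N & embeds_Zn G n).
Proof.
have [|bounded] := pselect (forall k, exists2 n, (k < n)%N & embeds_Zn G n).
  by right.
left; have [k kP] : exists k, forall n, embeds_Zn G n -> (n <= k)%N.
  apply: contrapT => no; apply: bounded => k.
  apply: contrapT => nk; apply: no; exists k => n en.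
  by rewrite leqNgt; apply/negP => kn; apply: nk; exists n.
have e0 : embeds_Zn G 0.
  by apply/embeds_ZnP; exists (fun=> 0) => v _; apply/rowP => -[].
have ex : exists n, `[< embeds_Zn G n >] by exists 0%N; exact/asboolP.
have bd n : `[< embeds_Zn G n >] -> (n <= k)%N by move/asboolP/kP.
case: (ex_maxnP ex bd) => n /asboolP en nmax.
by exists n; split=> // j /asboolP/nmax.
Qed.

(** If m were 1 from some rank on, the spans would stabilise and G would be finitely generated. So a
    factor at least 2 occurs beyond every rank. *)
Lemma place_unbounded (G : zmodType) (g : nat -> G) (m : nat -> nat) n :
    (forall x, exists k, span g k x) ->
    (forall k z, span g k (g k *~ z) <-> (m k %| z)%Z) ->
    (forall i, (n <= i)%N -> (0 < m i)%N) -> ~ finitely_generated G ->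
  forall B, exists k, (B <= place m n k)%N.
Proof.
move=> full mP mpos nfg.
have placeS k : place m n k.+1 = (place m n k * m (n + k))%N.
  by rewrite /place big_ord_recr.
have place_mono k d : (place m n k <= place m n (d + k))%N.
  elim: d => // d IHd; rewrite addSn placeS.
  by apply: leq_trans IHd _; rewrite leq_pmulr // mpos ?leq_addr.
have large J : exists2 i, (J <= i)%N & (1 < m (n + i))%N.
  apply: contrapT => small; apply: nfg; apply/(finitely_generatedP full).
  exists (n + J)%N => x; have [k xk] := full x.
  have {}xk : span g (k + (n + J)) x by apply: span_le xk; exact: leq_addr.
  elim: k xk => // k IHk; rewrite addSn => -[z xz]; apply: IHk.
  rewrite -(subrK (g (k + (n + J))%N *~ z) x); apply: spanD => //; apply/mP.
  suff -> : m (k + (n + J))%N = 1%N by rewrite dvd1z.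
  apply/eqP; rewrite eqn_leq mpos ?andbT; last by rewrite addnCA leq_addr.
  rewrite leqNgt; apply/negP => h; apply: small; exists (k + J)%N.
    exact: leq_addl.
  by rewrite addnCA in h *.
elim=> [|B [k Bk]]; first by exists 0%N.
have [i ki i2] := large k; exists i.+1; rewrite placeS.
have := place_mono k (i - k)%N; rewrite subnK // => h.
have p0 : (0 < place m n i)%N.
  by apply: prodn_cond_gt0 => j _; rewrite mpos // leq_addr.
have : (place m n i * 2 <= place m n i * m (n + i))%N by rewrite leq_mul2l i2 orbT.
lia.
Qed.

Lemma vec_near_leq n k l (u v : 'rV[int]_n) :
  (k <= l)%N -> vec_near k u v -> vec_near l u v.
Proof. by move=> kl uv i; exact: leq_trans (uv i) kl. Qed.

Lemma vec_near_gauge n : gauge (@vec_near n).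
Proof.
split=> [k u v uv i|k l]; first by have := uv i; move: (u 0 i) (v 0 i); lia.
exists (k + l)%N => u v w uv vw i; have := uv i; have := vw i.
by move: (u 0 i) (v 0 i) (w 0 i); lia.
Qed.

Section MixedModels.
Variables (n : nat).

Lemma mixed_near_leq (m : nat -> nat) k l (a b : 'rV[int]_n * nat) :
    place_values (place m n) -> (k <= l)%N ->
  mixed_near m k a b -> mixed_near m l a b.
Proof.
move=> [_ pdvd _ _] kl [ab1 ab2]; split; first exact: vec_near_leq ab1.
have /dvdnP[q ->] : (place m n k %| place m n l)%N.
  by rewrite -(subnK kl); elim: (l - k)%N => // d; move/dvdn_trans; apply; exact: pdvd.
by rewrite mulnC !divnMA ab2.
Qed.

Lemma mixed_near_gauge (m : nat -> nat) :
  place_values (place m n) -> gauge (@mixed_near m n).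
Proof.
move=> pv; have [vsym vtrans] := vec_near_gauge n.
split=> [k a b [ab1 ab2]|k l]; first by split=> //; exact: vsym.
have [j jP] := vtrans k l.
exists (maxn j (maxn k l)) => a b c ab bc; split.
  by apply: (@vec_near_leq _ j); [exact: leq_maxl|exact: jP ab.1 bc.1].
have [_ ->] : mixed_near m (maxn j (maxn k l)) a b.
  by apply: mixed_near_leq ab; rewrite // !leq_max leqnn orbT.
have [_ -> //] : mixed_near m (maxn j (maxn k l)) b c.
by apply: mixed_near_leq bc; rewrite // !leq_max leqnn !orbT.
Qed.

Lemma mixed_models_equiv (m m' : nat -> nat) :
    place_values (place m n) -> place_values (place m' n) ->
  exists f, coarse_equiv (@mixed_near m n) (@mixed_near m' n) f.
Proof.
move=> pv pv'; have [h [hsurj hE hF]] := place_values_coarse pv pv'.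
exists (fun a => (a.1, h a.2)); split=> [k|l|].
- have [l lP] := hE k; exists (maxn k l) => a b [ab1 ab2].
  have : mixed_near m' (maxn k l) (a.1, h a.2) (b.1, h b.2); last by [].
  split; first exact: vec_near_leq (leq_maxl k l) ab1.
  suff [] : mixed_near m' (maxn k l) (a.1, h a.2) (a.1, h b.2) by [].
  apply: (@mixed_near_leq _ l); rewrite ?leq_maxr //; split=> [i|]; last exact: lP.
  by rewrite subrr.
- have [k kP] := hF l; exists (maxn k l) => a b [ab1 ab2].
  split; first exact: vec_near_leq (leq_maxr k l) ab1.
  suff [] : mixed_near m (maxn k l) (a.1, a.2) (a.1, b.2) by [].
  apply: (@mixed_near_leq _ k); rewrite ?leq_maxl //; split=> [i|]; last exact: kP.
  by rewrite subrr.
- exists 0%N => -[v y]; have [x xy] := hsurj y; exists (v, x).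
  by split=> [i|]; rewrite /= ?subrr // xy.
Qed.

End MixedModels.

(** * Classification of groups with proper lengths *)

Definition Zn_rank (G : zmodType) n :=
  embeds_Zn G n /\ forall k, embeds_Zn G k -> (k <= n)%N.

Definition infinite_rank (G : zmodType) :=
  forall k, exists2 n, (k < n)%N & embeds_Zn G n.

Section Classification.
Variables (G H : zmodType) (lenG : G -> nat) (lenH : H -> nat).
Hypotheses (countG : countable [set: G]) (countH : countable [set: H]).
Hypotheses (properG : proper_length lenG) (properH : proper_length lenH).

Let via X (E : nat -> X -> X -> Prop) : gauge E ->
    (exists f, coarse_equiv (len_near lenG) E f) ->
    (exists f, coarse_equiv (len_near lenH) E f) ->
  exists f, coarse_equiv (len_near lenG) (len_near lenH) f.
Proof.
move=> gE [f fP] [h hP]; have [h' [h'P _ _]] := coarse_equiv_inv gE hP.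
exists (h' \o f); exact: coarse_equiv_comp (len_near_gauge properH) fP h'P.
Qed.

Lemma infinite_rank_coarse_equiv : infinite_rank G -> infinite_rank H ->
  exists f, coarse_equiv (len_near lenG) (len_near lenH) f.
Proof.
move=> rG rH; apply: (via digits_near_gauge).
  have [enum enumP] := countable_surj countG.
  have [g [m [full mP m0 m1]]] := infinite_rank_sequence enumP rG.
  exact: infinite_rank_model full mP properG m0 m1.
have [enum enumP] := countable_surj countH.
have [g [m [full mP m0 m1]]] := infinite_rank_sequence enumP rH.
exact: infinite_rank_model full mP properH m0 m1.
Qed.

Lemma finite_rank_coarse_equiv n : Zn_rank G n -> Zn_rank H n ->
    finitely_generated G /\ finitely_generated H \/
    ~ finitely_generated G /\ ~ finitely_generated H ->
  exists f, coarse_equiv (len_near lenG) (len_near lenH) f.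
Proof.
move=> [eG maxG] [eH maxH].
have [enumG enumGP] := countable_surj countG.
have [enumH enumHP] := countable_surj countH.
have [g [m [fullG mP m0 m1]]] := finite_rank_sequence enumGP eG maxG.
have [h [l [fullH lP l0 l1]]] := finite_rank_sequence enumHP eH maxH.
case=> [[fgG fgH]|[nfgG nfgH]].
  have [J JP] := (finitely_generatedP fullG).1 fgG.
  have [K KP] := (finitely_generatedP fullH).1 fgH.
  apply: (via (@vec_near_gauge n)).
    exact (finite_rank_fg_model fullG mP properG m0 m1 JP).
  exact (finite_rank_fg_model fullH lP properH l0 l1 KP).
have uG := place_unbounded fullG mP m1 nfgG.
have uH := place_unbounded fullH lP l1 nfgH.
have pG := place_place_values m1 uG; have pH := place_place_values l1 uH.
have [f fP] := mixed_models_equiv pG pH.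
apply: (via (mixed_near_gauge pH)).
  have [f' f'P] := finite_rank_model fullG mP properG m0 m1 uG.
  by exists (f \o f'); exact: coarse_equiv_comp (mixed_near_gauge pH) f'P fP.
exact (finite_rank_model fullH lP properH l0 l1 uH).
Qed.

End Classification.

(** * Lower bound for the asymptotic dimension *)

Section LowerBound.
Variables (G : zmodType) (len : G -> nat) (n : nat) (e : 'I_n -> G).
Hypotheses (properG : proper_length len) (ind : independent e).
Local Notation L := (lin_comb e).

Lemma len_lin_comb u v k : vec_near k u v ->
  (len (L u - L v)%R <= k * \sum_i len (e i))%N.
Proof.
move=> uv; rewrite -raddfB big_distrr /= /lin_comb.
apply: leq_trans (len_sum properG _ _) _; apply: leq_sum => i _.
apply: leq_trans (lenMz properG _ _) _; rewrite leq_mul2r !mxE.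
by apply/orP; right; exact: uv.
Qed.

Lemma lin_comb_proper B : exists K, forall u v,
  (len (L u - L v)%R <= B)%N -> vec_near K u v.
Proof.
have [_ _ _ proper] := properG.
pose p x : 'rV[int]_n := xget 0 [set v | L v = x].
pose s x := (\sum_i `|p x 0%R i|)%N.
have [K hK] := proper s B; exists K => u v uv i.
have := hK _ uv; apply: leq_trans; rewrite -raddfB /s /p.
case: xgetP => [w _ /= wE|/(_ (u - v)) []//].
have -> : w = u - v.
  by apply/eqP; rewrite -subr_eq0; apply/eqP/ind; rewrite raddfB /= wE subrr.
by rewrite (bigD1 i) //= !mxE leq_addr.
Qed.

(** If k < n, each of the k + 1 colours is the index of a coordinate of Z^n. The test F_j asks
    whether a bounded perturbation of the j-th coordinate, constant around each class of colour j,
    has passed a threshold. On the cube given by [hex] every F_j changes; yet for j the colour of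
    the base vertex, F_j is constant on the cube. *)
Lemma coloring_dim_ge k :
    (forall D : nat, exists (W : Type) (c : G -> 'I_k.+1) (r : G -> W) (B : nat),
      (forall x y, c x = c y -> len_near len D x y -> r x = r y) /\
      (forall x y, c x = c y -> r x = r y -> len_near len B x y)) ->
  (n <= k)%N.
Proof.
move=> col; rewrite leqNgt; apply/negP => kn.
have [W [c [r [B [near_r r_near]]]]] := col (2 * \sum_i len (e i))%N.
have [K hK] := lin_comb_proper B.
pose colored (j : 'I_n) u := c (L u) = j :> nat.
pose hit j (x : 'rV[int]_n) := [set u | vec_near 1 x u /\ colored j u].
pose rep j (x : 'rV[int]_n) := xget 0 [set u | colored j u /\ r (L u) = r (L x)].
(* If a point of colour j lies within 1 of x, the coordinate is read at the representative of its
   class. Any two such points are within 2 of each other, the scale at which the colouring was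
   taken, so the choice does not matter. *)
pose F j (x : 'rV[int]_n) : bool :=
  K.+2%:Z <= (if pselect (hit j x !=set0) then rep j (xget 0 (hit j x)) else x) 0 j.
have F_hit j x : hit j x !=set0 -> F j x = (K.+2%:Z <= rep j (xget 0 (hit j x)) 0 j).
  by move=> hx; rewrite /F; case: pselect.
have F_miss j x : ~ (hit j x !=set0) -> F j x = (K.+2%:Z <= x 0 j).
  by move=> hx; rewrite /F; case: pselect.
have repP j u : colored j u -> vec_near K (rep j u) u.
  move=> ju; rewrite /rep; case: xgetP => [w _ [jw rw]|/(_ u)[]//].
  by apply/hK/r_near => //; apply/val_inj; exact: etrans jw (esym ju).
have same_rep j u v : colored j u -> colored j v -> vec_near 2 u v ->
    rep j u = rep j v.
  move=> ju jv uv; rewrite /rep (@near_r (L u) (L v)) //.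
    by apply/val_inj; exact: etrans ju (esym jv).
  exact: len_lin_comb.
have F_dist j (x : 'rV[int]_n) :
    exists2 y : 'rV[int]_n, F j x = (K.+2%:Z <= y 0 j) &
      (`|(x 0 j - y 0 j)%R| <= K.+1)%N.
  have [hx|/F_miss Fx] := pselect (hit j x !=set0); last first.
    by exists x; rewrite ?subrr.
  rewrite F_hit //.
  exists (rep j (xget 0 (hit j x))) => //.
  have /= [x1 jx] := xgetPex 0 hx; have := repP _ _ jx j; have := x1 j.
  by move: (x 0 j) (fun_of_matrix (xget _ _) 0 j) (fun_of_matrix (rep _ _) 0 j) => a b d; lia.
(* The coordinate is read at distance at most K + 1 from x, so the threshold K + 2 separates 0 from
   2 K + 4. *)
have F0 j (x : 'rV[int]_n) : x 0 j = 0 -> F j x = false.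
  by move=> x0; have [y -> ] := F_dist j x; rewrite x0; move: (y 0 j) => a; lia.
have F1 j (x : 'rV[int]_n) : x 0 j = (2 * K + 3).+1%:Z -> F j x = true.
  by move=> x0; have [y -> ] := F_dist j x; rewrite x0; move: (y 0 j) => a; lia.
have [x xF] := hex F0 F1.
have jn : (c (L x) < n)%N by exact: leq_trans (ltn_ord _) kn.
pose j := Ordinal jn.
have F_const (S : {set 'I_n}) :
    F j (x + \row_i (i \in S)%:Z) = (K.+2%:Z <= rep j x 0 j).
  set y := x + _.
  have yx : vec_near 1 y x.
    by move=> i; rewrite !mxE; case: (i \in S); move: (x 0 i) => a; lia.
  have hy : hit j y !=set0 by exists x.
  rewrite F_hit //; have /= [y1 jy] := xgetPex 0 hy.
  rewrite (@same_rep j _ x) // => i; have := y1 i; have := yx i.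
  by move: (y 0 i) (fun_of_matrix (xget _ _) 0 i) (x 0 i) => a b d; lia.
by have [R [S]] := xF j; rewrite !F_const eqxx.
Qed.

End LowerBound.

(** * Coarse geometry of metric spaces *)

Section CoarseMetric.
Variable R : realType.

Lemma ltey_bound (x : \bar R) : (x < +oo)%E -> exists B : R, (x <= B%:E)%E.
Proof.
by case: x => [r|//|] _; [exists r | exists 0; rewrite leNye].
Qed.

Lemma diam_leP (X : metricType R) (A : set X) (B : R) :
  (diam A <= B%:E)%E <->
  0 <= B /\ forall x y, A x -> A y -> mdist x y <= B.
Proof.
rewrite /diam ge_max lee_fin; split=> [/andP[B0 /ereal_supP AB]|[-> AB]].
  split=> // x y Ax Ay; rewrite -lee_fin; apply: AB.
  by exists (x, y).
by apply/ereal_supP => _ [[x y] [/= Ax Ay] <-]; rewrite lee_fin; exact: AB.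
Qed.

Lemma bornologousP (X Y : metricType R) (f : X -> Y) :
  bornologous f <->
  forall D, exists B, forall x y, mdist x y <= D -> mdist (f x) (f y) <= B.
Proof.
split=> bf D; last first.
  have [B BP] := bf D; apply: (@le_lt_trans _ _ (Num.max 0 B)%:E); last exact: ltry.
  apply/ereal_supP => _ [A /= /diam_leP[D0 AD] <-].
  apply/diam_leP; split; first by rewrite le_max lexx.
  move=> _ _ [x Ax <-] [y Ay <-]; rewrite le_max BP ?orbT //; exact: AD.
have [B BP] := ltey_bound (bf D).
exists B => x y xy; have D0 : 0 <= D := le_trans (mdist_ge0 x y) xy.
suff /diam_leP[_ h] : (diam (f @` [set x; y]) <= B%:E)%E.
  by apply: h; [exists x; [left|]|exists y; [right|]].
move/ereal_supP: BP; apply; exists [set x; y] => //=.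
apply/diam_leP; split=> // u v [->|->] [->|->]; rewrite ?mdistxx //.
by rewrite metric_sym.
Qed.

(** Each point retains the colour and the name of one set of the cover that contains it. In this
    form the notion pulls back along maps and passes to integer lengths. *)
Lemma asdim_leP (X : metricType R) n : asdim_le X n <->
  forall D : R, exists (W : Type) (c : X -> 'I_n.+1) (r : X -> W) (B : R),
    (forall x y, c x = c y -> mdist x y <= D -> r x = r y) /\
    (forall x y, c x = c y -> r x = r y -> mdist x y <= B).
Proof.
split=> [asdimX D|colX D D0].
  (* Discreteness only gives distances at least its parameter, so a parameter above D is used; D may
     be negative here. *)
  have D1 : 0 <= Num.max 0 D + 1 by rewrite addr_ge0 // le_max lexx.
  have [F [covF bdF [Fi [FE Fdisc]]]] := asdimX _ D1.
  have /choice[p pP] x : exists p : 'I_n.+1 * set X, Fi p.1 p.2 /\ p.2 x.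
    have : cover F id x by rewrite covF.
    by case=> U /=; rewrite FE => -[i _ FiU] Ux; exists (i, U).
  have [B BP] := ltey_bound bdF.
  exists (set X), (fun x => (p x).1), (fun x => (p x).2), B; split=> x y cxy.
    move=> xyD; apply: contrapT => rxy.
    have [Fx px] := pP x; have [Fy py] := pP y; rewrite -cxy in Fy.
    have /ereal_infP h := Fdisc _ _ _ Fx Fy rxy.
    have : ((Num.max 0 D + 1)%:E <= (mdist x y)%:E)%E by apply: h; exists (x, y).
    rewrite lee_fin; apply/negP; rewrite -ltNge (le_lt_trans xyD) //.
    by rewrite ltr_pwDr // le_max lexx orbT.
  move=> rxy; have [Fx px] := pP x; have [Fy py] := pP y; rewrite -rxy in py.
  have /diam_leP[_ h] : (diam (p x).2 <= B%:E)%E.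
    by move/ereal_supP: BP; apply; exists (p x).2; rewrite ?FE //; exists (p x).1.
  exact: h.
have [W [c [r [B [near_r r_near]]]]] := colX D.
pose Fi (i : 'I_n.+1) : set (set X) := [set [set x | c x = i /\ r x = w] | w in setT].
exists (\bigcup_i Fi i); split.
- apply/seteqP; split=> // x _; exists [set y | c y = c x /\ r y = r x] => //.
  by exists (c x) => //; exists (r x).
- apply: (@le_lt_trans _ _ (Num.max 0 B)%:E); last exact: ltry.
  apply/ereal_supP => _ [_ [i _ [w _ <-]] <-]; apply/diam_leP; split.
    by rewrite le_max lexx.
  move=> x y [cx rx] [cy ry]; rewrite le_max r_near ?orbT ?rx ?ry //.
  by rewrite cx cy.
- exists Fi; split=> // i _ _ [v _ <-] [w _ <-] vw.
  apply/ereal_infP => _ [[x y] [/= [cx rx] [cy ry]] <-]; rewrite lee_fin.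
  rewrite leNgt; apply/negP => /ltW xyD; apply: vw.
  have rxy := near_r x y (etrans cx (esym cy)) xyD.
  by have -> : v = w by rewrite -rx -ry.
Qed.

Lemma coarsely_equivalent_sym (X Y : metricType R) :
  coarsely_equivalent X Y -> coarsely_equivalent Y X.
Proof. by move=> [f [h [K [? ? ? ?]]]]; exists h, f, K. Qed.

Lemma asdim_le_coarse (X Y : metricType R) n :
  coarsely_equivalent X Y -> asdim_le Y n -> asdim_le X n.
Proof.
move=> [f [h [K [/bornologousP bf /bornologousP bh hf _]]]] /asdim_leP colY.
apply/asdim_leP => D; have [D' fD] := bf D.
have [W [c [r [B [near_r r_near]]]]] := colY D'.
have [B' hB] := bh B; exists W, (c \o f), (r \o f), (K + B' + K).
split=> x y /= cxy; first by move/fD; exact: near_r.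
move/(r_near _ _ cxy)/hB => le.
apply: le_trans (metric_triangle _ (h (f y)) _) _; apply: lerD; last exact: hf.
apply: le_trans (metric_triangle _ (h (f x)) _) _; apply: lerD => //.
by rewrite metric_sym.
Qed.

Lemma asdim_coarse (X Y : metricType R) :
  coarsely_equivalent X Y -> asdim X = asdim Y.
Proof.
move=> XY; have e : asdim_le X = asdim_le Y.
  apply/funext => n; apply/propext; split; last exact: asdim_le_coarse.
  exact/asdim_le_coarse/coarsely_equivalent_sym.
by rewrite /asdim e.
Qed.

Lemma large_scale_connected_coarse (X Y : metricType R) :
  coarsely_equivalent X Y -> large_scale_connected X -> large_scale_connected Y.
Proof.
move=> [f [h [K [/bornologousP bf _ _ fh]]]] [eps eps0 connX].
have [B BP] := bf eps.
pose E := Num.max 0 (Num.max B K).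
have EB : B <= E by rewrite !le_max lexx orbT.
have EK : K <= E by rewrite !le_max lexx !orbT.
exists E => [|x y]; first by rewrite le_max lexx.
have [s [sP sy]] := connX (h x) (h y).
exists (f (h x) :: rcons (map f s) y); split; last by rewrite /= last_rcons.
rewrite /= metric_sym (le_trans (fh x)) //= rcons_path; apply/andP; split.
  rewrite path_map; apply: sub_path sP => u v /= /BP uv; exact: le_trans uv EB.
by rewrite last_map sy (le_trans (fh y)).
Qed.

End CoarseMetric.

(** * Proper invariant metrics *)

Section ProperInvariantMetric.
Variables (R : realType) (G : zmodType) (d : metric R G).
Hypotheses (countG : countable [set: G]) (proper : proper_metric (metrized d))
  (invariant : left_invariant d).
Local Notation X := (metrized d).

Lemma mdist_metrized (x y : X) : mdist x y = d x y.
Proof. by []. Qed.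

Let d_ge0 x y : 0 <= d x y.
Proof. exact: (@mdist_ge0 R X x y). Qed.

Let d_sub x y : d x y = d 0 (y - x).
Proof. by rewrite -(invariant x 0) addr0 addrC subrK. Qed.

(* The points of the compact ball cannot all be avoided by a decreasing
   sequence of closed balls, so some point, hence every point, is isolated. *)
Lemma isolated : exists2 eps : R, 0 < eps & forall x, d 0 x < eps -> x = 0.
Proof.
have [//|none] := pselect (exists2 eps : R, 0 < eps & forall x, d 0 x < eps -> x = 0).
have small (eps : R) : 0 < eps -> exists2 x, x != 0 & d 0 x < eps.
  move=> e0; apply: contrapT => no; apply: none; exists eps => // x xe.
  by apply: contrapT => /eqP x0; apply: no; exists x.
have [enum enumP] := countable_surj countG.
(* From a ball and an element g, a smaller closed ball inside it that misses g. If g is the centre,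
   a short translation first moves the centre away. *)
have /choice[next nextP] (a : G * R * G) : exists b : G * R, 0 < a.1.2 ->
    [/\ 0 < b.2, d a.1.1 b.1 + b.2 <= a.1.2 & b.2 < d b.1 a.2].
  case: a => -[x r] g /=; have [r0|r0] := ltP 0 r; last first.
    by exists (x, r).
  have [y [xy yg]] : exists y, d x y < r / 2 /\ y != g.
    have [z z0 zr] := small (r / 2) (divr_gt0 r0 (ltr0Sn _ 1)).
    have [xg|xg] := eqVneq x g; last by exists x; rewrite distxx divr_gt0.
    exists (x + z); rewrite d_sub [x + z]addrC addrK zr; split=> //.
    by rewrite xg -subr_eq0 addrK.
  have yg0 : 0 < d y g.
    rewrite lt_neqAle d_ge0 andbT eq_sym; apply/eqP => yg0.
    by rewrite (@dist_positivity _ _ d _ _ yg0) eqxx in yg.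
  exists (y, Num.min (r / 2) (d y g / 2)) => _ /=; split.
  - by rewrite lt_min !divr_gt0.
  - have : Num.min (r / 2) (d y g / 2) <= r / 2 by rewrite ge_min lexx.
    lra.
  - by rewrite gt_min; apply/orP; right; lra.
pose u := fix u k : G * R := if k is k'.+1 then next (u k', enum k') else (0, 1).
have u_gt0 k : 0 < (u k).2.
  by elim: k => [|k IHk] //=; have [] := nextP (u k, enum k) IHk.
have u_step k : d (u k).1 (u k.+1).1 + (u k.+1).2 <= (u k).2.
  by have [] := nextP (u k, enum k) (u_gt0 k).
have u_nested k l : d (u k).1 (u (l + k)%N).1 + (u (l + k)%N).2 <= (u k).2.
  elim: l => [|l IHl]; first by rewrite distxx add0r.
  have := u_step (l + k)%N; have := dist_triangle d (u (l + k)%N).1 (u k).1 (u (l + k).+1).1.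
  by rewrite addSn; lra.
have u_in k l : (k <= l)%N -> d (u k).1 (u l).1 <= (u k).2.
  by move=> kl; have := u_nested k (l - k)%N; rewrite subnK //; have := u_gt0 l; lra.
pose F : set_system X := [set S | exists k, forall l, (k <= l)%N -> S (u l).1].
have FF : ProperFilter F.
  split; first by move=> [k /(_ k (leqnn k))].
  split.
  - by exists 0%N.
  - move=> A B [k kA] [l lB]; exists (maxn k l) => j.
    by rewrite geq_max => /andP[/kA ? /lB ?].
  - by move=> A B AB [k kA]; exists k => l /kA; exact: AB.
have [] := @proper (0 : X) 1 F FF.
  by exists 0%N => l _; exact: (u_in 0%N l).
move=> p [_ pF].
have p_in k : d (u k).1 p <= (u k).2.
  rewrite leNgt; apply/negP => kp.
  have e0 : 0 < d (u k).1 p - (u k).2 by lra.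
  have Fk : F [set y | d (u k).1 y <= (u k).2] by exists k => l; exact: u_in.
  have [y [/= uy]] := pF _ _ Fk (nbhsx_ballx (p : X) _ e0).
  rewrite ballEmdist /= mdist_metrized => py.
  have := dist_triangle d y (u k).1 p; rewrite (dist_sym d y p); lra.
have [k kp] := enumP p.
have [_ _ lt] := nextP (u k, enum k) (u_gt0 k).
by have := p_in k.+1; rewrite leNgt => /negP[]; rewrite -kp; exact: lt.
Qed.

(** On an infinite ball the cofinite subsets generate a proper filter; by compactness it would have
    a cluster point, which is impossible as all points are isolated. *)
Lemma finite_ball r : finite_set [set x | d 0 x <= r].
Proof.
have [eps e0 eP] := isolated.
apply: contrapT => inf; pose A : set X := [set x | d 0 x <= r].
pose F : set_system X := [set S | finite_set (A `\` S)].
have FF : ProperFilter F.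
  split; first by rewrite /F /= setD0.
  split.
  - by rewrite /F /= setDT; exact: finite_set0.
  - by move=> S T FS FT; rewrite /F /= setDIr finite_setU.
  - by move=> S T ST; apply: sub_finite_set; exact: setDS.
have [] := @proper (0 : X) r F FF.
  by rewrite /F /= setDv; exact: finite_set0.
move=> p [_ pF].
have Fp : F (~` [set p]).
  apply: (sub_finite_set _ (finite_set1 p)) => x [_ /=]; exact: contrapT.
have [y [/= yp]] := pF _ _ Fp (nbhsx_ballx (p : X) _ e0).
rewrite ballEmdist /= mdist_metrized d_sub => /eP/eqP.
by rewrite subr_eq0 => /eqP.
Qed.

(** Rounding up makes the integer balls those of the metric, so the entourages with integer radius
    are unchanged. *)
Definition metric_length (x : G) : nat := absz (Num.ceil (d 0 x)).

Lemma metric_length_le x k : (metric_length x <= k)%N = (d 0 x <= k%:R).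
Proof.
have c0 : 0 <= Num.ceil (d 0 x) by rewrite ceil_ge0; have := d_ge0 0 x; lra.
by rewrite /metric_length -lez_nat gez0_abs // ceil_le_int.
Qed.

Lemma metric_length_near k x y : len_near metric_length k x y <-> d x y <= k%:R.
Proof. by rewrite /len_near metric_length_le (dist_sym d x y) (d_sub y x). Qed.

Lemma metric_length_proper : proper_length metric_length.
Proof.
have lenE x : d 0 x <= (metric_length x)%:R by rewrite -metric_length_le.
have lenN x : (metric_length (- x) <= metric_length x)%N.
  by rewrite metric_length_le -(invariant x) addr0 subrr dist_sym.
split=> [|x|x y|s r].
- by apply/eqP; rewrite -leqn0 metric_length_le distxx.
- by apply/eqP; rewrite eqn_leq lenN -{1}(opprK x) lenN.
- rewrite metric_length_le natrD; apply: le_trans (dist_triangle d x _ _) _.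
  by apply: lerD => //; rewrite d_sub [x + y]addrC addrK.
- have [K KP] := finite_set_bound s (finite_ball r%:R).
  by exists K => x; rewrite metric_length_le => /KP.
Qed.

Lemma real_le_nat (r : R) : exists k : nat, r <= k%:R.
Proof.
exists (Num.truncn r).+1; have [r0|/ltW r0] := leP 0 r.
  by have /andP[_ /ltW] := truncn_itv r0.
exact: le_trans r0 _.
Qed.

Lemma asdim_le_coloring n : asdim_le X n <->
  forall D : nat, exists (W : Type) (c : G -> 'I_n.+1) (r : G -> W) (B : nat),
    (forall x y, c x = c y -> len_near metric_length D x y -> r x = r y) /\
    (forall x y, c x = c y -> r x = r y -> len_near metric_length B x y).
Proof.
split=> [/asdim_leP colX D|col].
  have [W [c [r [B [near_r r_near]]]]] := colX D%:R.
  have [k Bk] := real_le_nat B; exists W, c, r, k; split=> x y cxy.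
    by move/metric_length_near; exact: near_r.
  move=> rxy; apply/metric_length_near; exact: le_trans (r_near x y cxy rxy) Bk.
apply/asdim_leP => D; have [k Dk] := real_le_nat D.
have [W [c [r [B [near_r r_near]]]]] := col k.
exists W, c, r, B%:R; split=> x y cxy.
  move=> xy; apply: near_r => //; apply/metric_length_near; exact: le_trans xy Dk.
by move=> rxy; apply/metric_length_near; exact: r_near.
Qed.

Lemma asdim_le_rank n : Zn_rank G n -> asdim_le X n.
Proof.
move=> [eG maxG]; apply/asdim_le_coloring => D.
have [enum enumP] := countable_surj countG.
have [g [m [full mP m0 m1]]] := finite_rank_sequence enumP eG maxG.
exact (finite_rank_coloring full mP metric_length_proper m1 D).
Qed.

Lemma rank_le_asdim k n : embeds_Zn G n -> asdim_le X k -> (n <= k)%N.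
Proof.
move=> /embeds_ZnP[e ind] /asdim_le_coloring.
exact: coloring_dim_ge metric_length_proper ind _.
Qed.

Lemma asdim_finite_rank n : Zn_rank G n -> asdim X = n%:R%:E.
Proof.
move=> rG; have An := asdim_le_rank rG; rewrite /asdim.
case: pselect => [ex|[]]; last by exists n; exact/asboolP.
case: ex_minnP => k /asboolP Ak kmin; congr (_%:R%:E); apply/eqP.
rewrite eqn_leq kmin ?andbT //; last exact/asboolP.
exact: rank_le_asdim rG.1 Ak.
Qed.

Lemma asdim_infinite_rank : infinite_rank G -> asdim X = +oo%E.
Proof.
move=> rG; rewrite /asdim; case: pselect => // ex; exfalso; have [k /asboolP Ak] := ex.
have [n kn en] := rG k; have := rank_le_asdim en Ak.
by rewrite leqNgt kn.
Qed.

Lemma torsion_free_rank_finite n : Zn_rank G n -> torsion_free_rank R G = n%:R%:E.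
Proof.
move=> [en nmax]; apply/eqP; rewrite eq_le; apply/andP; split.
  by apply/ereal_supP => _ [k ek <-]; rewrite lee_fin ler_nat; exact: nmax.
by apply: ereal_sup_ubound; exists n.
Qed.

Lemma torsion_free_rank_infinite : infinite_rank G -> torsion_free_rank R G = +oo%E.
Proof.
move=> rG; apply/eqP; rewrite eq_le leey /= leNgt; apply/negP => ltey.
have [B] := ltey_bound ltey.
have [k Bk] := real_le_nat B; have [n kn en] := rG k.
move=> /ereal_supP supB; have nB : (n%:R%:E <= B%:E)%E by apply: supB; exists n.
rewrite lee_fin in nB; have := le_trans nB Bk.
by rewrite ler_nat leqNgt kn.
Qed.

Lemma asdim_torsion_free_rank : asdim X = torsion_free_rank R G.
Proof.
have [[n rG]|rG] := embeds_Zn_cases G.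
  by rewrite (asdim_finite_rank rG) (torsion_free_rank_finite rG).
by rewrite (asdim_infinite_rank rG) (torsion_free_rank_infinite rG).
Qed.

Let chain (eps : R) (x y : X) := exists s : seq X,
  path (fun u v => mdist u v <= eps) x s /\ last x s = y.

(** A chain from 0 writes its end as a sum of elements of a ball, which is finite. Conversely, if K
    bounds the lengths of the generators, the points linked to 0 by K-chains form a subgroup, by
    invariance, and it contains the generators. *)
Lemma large_scale_connected_fg : large_scale_connected X <-> finitely_generated G.
Proof.
split=> [[eps eps0 conn]|[A finA genA]].
  exists [set x | d 0 x <= eps]; first exact: finite_ball.
  apply/seteqP; split=> // x _ B [[B0 BB] ballB].
  have {}B0 : B 0 by move: B0; rewrite inE.
  have BS a b : B a -> B b -> B (a - b).
    by move=> Ba Bb; have := BB a b; rewrite !inE; apply.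
  have BD a b : B a -> B b -> B (a + b).
    by move=> Ba Bb; rewrite -[b]opprK -[- b]sub0r; apply: (BS) => //; exact: BS.
  have [s [sP <-]] := conn (0 : X) x.
  elim: s (0 : X) B0 sP => //= y s IHs z Bz /andP[zy ys].
  apply: IHs ys; rewrite -[y](subrK z) addrC; apply: BD => //.
  by apply: ballB; rewrite /= -d_sub.
have [K KP] := finite_set_bound metric_length finA.
have ctrans x y z : chain K%:R x y -> chain K%:R y z -> chain K%:R x z.
  move=> [s [sP sy]] [t [tP tz]]; exists (s ++ t).
  by rewrite cat_path sP sy last_cat sy.
have csym x y : chain K%:R x y -> chain K%:R y x.
  move=> [s [sP <-]] {y}; elim: s x sP => [|y s IHs] x /=; first by exists [::].
  move=> /andP[xy /IHs ys]; apply: ctrans ys _; exists [:: x]; split=> //=.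
  by rewrite metric_sym xy.
have cshift (z x y : G) : chain K%:R x y -> chain K%:R (z + x) (z + y).
  move=> [s [sP <-]] {y}; exists (map (fun t => z + t) s); split; last first.
    by rewrite last_map.
  rewrite path_map; apply: sub_path sP => u v /=.
  by rewrite !mdist_metrized invariant.
exists K%:R => // x y.
suff : [set: G] `<=` [set z | chain K%:R 0 z].
  move=> /(_ (- x + y) I)/(cshift x); by rewrite addr0 addrA subrr add0r.
rewrite -genA; apply: smallest_sub; last first.
  move=> a /KP; rewrite metric_length_le => a0; exists [:: (a : X)].
  by rewrite /= mdist_metrized a0.
split; first by rewrite inE; exists [::].
move=> a b; rewrite !inE /= => ca cb; apply: ctrans ca _.
by have := cshift (a - b) _ _ (csym _ _ cb); rewrite addr0 subrK => /csym/csym.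
Qed.

End ProperInvariantMetric.

(** * From lengths back to metrics *)

Lemma coarse_equiv_bornologous (R : realType) (G H : zmodType)
    (dG : metric R G) (dH : metric R H) (f : G -> H) :
    left_invariant dG -> left_invariant dH ->
    coarse_equiv (len_near (metric_length dG)) (len_near (metric_length dH)) f ->
  @bornologous R (metrized dG) (metrized dH) f.
Proof.
move=> invG invH [fP _ _]; apply/bornologousP => D.
have [k Dk] := real_le_nat D; have [l lP] := fP k.
exists l%:R => x y xy; apply/(metric_length_near invH)/lP.
by apply/(metric_length_near invG); exact: le_trans xy Dk.
Qed.

Lemma coarse_equiv_metrized (R : realType) (G H : zmodType)
    (dG : metric R G) (dH : metric R H) (f : G -> H) :
    left_invariant dG -> left_invariant dH ->
    gauge (len_near (metric_length dH)) ->
    coarse_equiv (len_near (metric_length dG)) (len_near (metric_length dH)) f ->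
  coarsely_equivalent (metrized dG) (metrized dH).
Proof.
move=> invG invH gH fP; have [h [hP [k kP] [l lP]]] := coarse_equiv_inv gH fP.
exists f, h, (maxn k l)%:R; split.
- exact: coarse_equiv_bornologous fP.
- exact: coarse_equiv_bornologous hP.
- move=> x; apply/(metric_length_near invG).
  by rewrite /len_near leq_max; apply/orP; left; exact: kP.
- move=> y; apply/(metric_length_near invH).
  by rewrite /len_near leq_max; apply/orP; right; exact: lP.
Qed.

Theorem theorem1 (R : realType) (G H : zmodType)
    (countable_G : countable [set: G]) (countable_H : countable [set: H])
    (dG : metric R G) (dH : metric R H)
    (proper_dG : proper_metric (metrized dG))
    (proper_dH : proper_metric (metrized dH))
    (invariant_dG : left_invariant dG) (invariant_dH : left_invariant dH) :
  [<-> coarsely_equivalent (metrized dG) (metrized dH);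
       asdim (metrized dG) = asdim (metrized dH) /\
       (large_scale_connected (metrized dG) /\
          large_scale_connected (metrized dH) \/
        ~ large_scale_connected (metrized dG) /\
          ~ large_scale_connected (metrized dH));
       torsion_free_rank R G = torsion_free_rank R H /\
       (finitely_generated G /\ finitely_generated H \/
        ~ finitely_generated G /\ ~ finitely_generated H)].
Proof.
have lscG := large_scale_connected_fg countable_G proper_dG invariant_dG.
have lscH := large_scale_connected_fg countable_H proper_dH invariant_dH.
have lenG := metric_length_proper countable_G proper_dG invariant_dG.
have lenH := metric_length_proper countable_H proper_dH invariant_dH.
tfae.
- move=> GH; split; first exact: asdim_coarse.
  have HG := coarsely_equivalent_sym GH.
  have [cG|nG] := pselect (large_scale_connected (metrized dG)); [left|right].
    by split=> //; exact: large_scale_connected_coarse cG.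
  by split=> // /(large_scale_connected_coarse HG).
- rewrite !asdim_torsion_free_rank // => -[rank conn]; split=> //.
  case: conn => [[/lscG cG /lscH cH]|[nG nH]]; first by left.
  by right; split=> [/lscG|/lscH].
- move=> [rank fg].
  have [f fP] : exists f,
      coarse_equiv (len_near (metric_length dG)) (len_near (metric_length dH)) f.
    have [[n rG]|rG] := embeds_Zn_cases G; have [[k rH]|rH] := embeds_Zn_cases H.
    + have nk : n = k.
        move: rank; rewrite (torsion_free_rank_finite R rG) (torsion_free_rank_finite R rH).
        by move=> e; apply/eqP; rewrite -(eqr_nat R); apply/eqP/EFin_inj.
      rewrite -nk in rH; exact: finite_rank_coarse_equiv rG rH fg.
    + by move: rank; rewrite (torsion_free_rank_finite R rG) torsion_free_rank_infinite.
    + by move: rank; rewrite (torsion_free_rank_finite R rH) torsion_free_rank_infinite.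
    + exact: infinite_rank_coarse_equiv.
  exact: coarse_equiv_metrized (len_near_gauge lenH) fP.
Qed.
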